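(* Let $d\in\mathbb N$, $n\in(0,3/2)$, and let $H\in C^3((0,1))\cap C^1([0,1])$ with $H>0$ for $x\in(0,1]$ be the unique solution of $$H^{n-1}\Big(\frac{d^3H}{dx^3}-\frac{d-1}{1-x}\frac{d^2H}{dx^2}-\frac{d-1}{(1-x)^2}\frac{dH}{dx}\Big)=-1+x\ \text{ for } x\in(0,1),$$ $$\Big(H,\frac{dH}{dx}\Big)=(0,0)\ \text{ at } x=0,\qquad \frac{dH}{dx}=0\ \text{ at } x=1 .$$ Then $H$ satisfies $$H=\kappa x^2\Big(1+v\big(x,x^{\beta}\big)\Big)\qquad\text{for } 0\le x\ll1,$$ where $\kappa>0$ is an $n$-dependent constant, $\beta=3-2n$, and $v=v(x_1,x_2)$ is an analytic function in a neighborhood of $(x_1,x_2)=(0,0)$ with $v(0,0)=0$ but $v\not\equiv0$, with a non-trivial dependence on both $x_1$ and $x_2$.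
   Context: Here $d$ denotes the (fixed) space dimension in the coefficients $d-1$ (constants may depend on it), whereas $\frac{d^k}{dx^k}$ denotes differentiation in $x$. ''For $0\le x\ll1$'' means: there is a constant $c>0$ such that the assertion holds for all $0\le x\le c$. Existence and uniqueness of classical solutions (i.e. in the class $C^3((0,1))\cap C^1([0,1])$) of this problem, as well as the leading-order expansion $H=\kappa x^2(1+o(1))$ as $x\searrow0$, are known facts that may be presupposed. *)

(* Defs.v *)
From Stdlib Require Import Reals Lra.
From Coquelicot Require Import Coquelicot.

Open Scope R_scope.

(** Functions on [0,1] are represented by total functions [R -> R]; the
    definitions below only involve their values on [0,1]. *)
Definition I01 (x : R) : Prop := 0 <= x <= 1.

(** Derivative of [f : D -> R] at [x]; it is one-sided at an endpoint of an
    interval [D]. *)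
Definition is_derive_within (D : R -> Prop) (f : R -> R) (x l : R) : Prop :=
  filterlim (fun y => (f y - f x) / (y - x)) (within D (locally' x)) (locally l).

Definition C1_closed (f : R -> R) : Prop :=
  exists f' : R -> R,
    (forall x, I01 x -> is_derive_within I01 f x (f' x)) /\ continuous_on I01 f'.

Definition C3_open (f : R -> R) : Prop :=
  forall x, 0 < x < 1 ->
    (forall k, (k <= 3)%nat -> ex_derive_n f k x) /\ continuous (Derive_n f 3) x.

Record is_solution (d : nat) (n : R) (H : R -> R) : Prop := {
  sol_C3 : C3_open H;
  sol_C1 : C1_closed H;
  sol_pos : forall x, 0 < x <= 1 -> 0 < H x;
  sol_ode : forall x, 0 < x < 1 ->
    Rpower (H x) (n - 1) *
      (Derive_n H 3 x
       - (INR d - 1) / (1 - x) * Derive_n H 2 x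
       - (INR d - 1) / (1 - x) ^ 2 * Derive_n H 1 x) = - 1 + x;
  sol_val0 : H 0 = 0;
  sol_der0 : is_derive_within I01 H 0 0;
  sol_der1 : is_derive_within I01 H 1 0 }.

Definition is_unique_solution (d : nat) (n : R) (H : R -> R) : Prop :=
  is_solution d n H /\
  forall G, is_solution d n G -> forall x, I01 x -> G x = H x.

(** [Rpower 0 b] is [1] because [ln 0 = 0]; for [b > 0] the convention needed
    here is [0 ^ b = 0]. *)
Definition rpow (x b : R) : R := if Rlt_dec 0 x then Rpower x b else 0.

(** Absolute convergence of a double series, with sum [l]. Under absolute
    convergence the choice of square partial sums is immaterial. *)
Definition is_abs_double_series (a : nat -> nat -> R) (l : R) : Prop :=
  ex_finite_lim_seq
    (fun N => sum_n (fun i => sum_n (fun j => Rabs (a i j)) N) N) /\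
  is_lim_seq (fun N => sum_n (fun i => sum_n (fun j => a i j) N) N) l.

Definition analytic_at (v : R -> R -> R) (p1 p2 : R) : Prop :=
  exists a : nat -> nat -> R,
    locally_2d (fun x1 x2 =>
      is_abs_double_series
        (fun i j => a i j * (x1 - p1) ^ i * (x2 - p2) ^ j) (v x1 x2)) p1 p2.

Definition analytic_near (v : R -> R -> R) (p1 p2 : R) : Prop :=
  locally_2d (analytic_at v) p1 p2.

(** On a neighbourhood of the origin, "independent of [x1]" (resp. of [x2])
    means [v x1 x2 = v 0 x2] (resp. [v x1 x2 = v x1 0]). *)
Definition depends_on_fst (v : R -> R -> R) : Prop :=
  ~ locally_2d (fun x1 x2 => v x1 x2 = v 0 x2) 0 0.

Definition depends_on_snd (v : R -> R -> R) : Prop :=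
  ~ locally_2d (fun x1 x2 => v x1 x2 = v x1 0) 0 0.

(* Main.v *)
Require Import Defs.
From Stdlib Require Import Reals Lra Lia Classical.
From Coquelicot Require Import Coquelicot.
From Stdlib Require Import List.
Import ListNotations.

Open Scope R_scope.

(** Put [m = d - 1] and [P = H'' - m / (1 - x) H'], so that the equation reads
    [P' = - (1 - x) H^(1-n)].  Hence [P] decreases; positivity of [H] forces [P > 0]
    near 0, so [H >= c x^2], and then [n < 3/2] makes [P'] integrable: [P] has a limit
    [2 kappa > 0] at 0 and [H = kappa x^2 (1 + u)] with [u = O(x^gamma)],
    [gamma = min (1, beta)].

    With [theta = x d/dx], [y = x / (1 - x)], [2 + a = x H' / H],
    [e = (x^2 P - x H') / H], [1 + s = (1 - x) (1 + u)^(-n)] and [sigma = kappa^(-n)],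
    the equation becomes the system
      [y = x (1 + y)],
      [(theta + 1) e = - a e - sigma x^beta (1 + s) - m y (2 + a)],
      [(theta + 2) a = e - a^2 + m y (2 + a)],
      [theta s = - (n a + y) (1 + s)],   [theta u = a (1 + u)],
    which is quadratic, so that its Picard iterates from 0 are polynomials in
    [x1 = x] and [x2 = x^beta].  The iteration contracts in the weighted l^1 norm of
    the coefficients, which yields [v], and by the same estimate the iterates converge
    to the functions coming from [H], whence [u = v (x, x^beta)].  The dependence on
    the variables is read off the coefficients of [x2], and of [x1] (if [d > 1]) or
    [x1 x2] (if [d = 1]). *)

(** * Polynomials in two variables as lists of monomials *)

(** Matching coefficients cannot identify [H] with the series: for rational beta, different
    monomials [x^i (x^beta)^j] coincide as functions of [x], so [H] does not determine [v]. Hence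
    [v] is built in two independent variables and then tied to [H] by an estimate along the curve
    [(x, x^beta)]. There are no small divisors: on a monomial other than 1, theta + k is
    multiplication by at least gamma + k. Functions enjoy the same gain: if [f] tends to 0 at 0 and
    (theta + k) f is bounded by M x^gamma, then [f] is bounded by M x^gamma / (gamma + k). So one
    scalar inequality serves both for norms of polynomials and for pointwise distances between
    functions. Taking [s] as an unknown of its own hides the power -n; no power series has to be
    composed with it. Linear couplings, which a small radius cannot tame, run only from [y] to [e]
    and [a], from [e] to [a], and from [y] and [a] to [s] and [u]; the way back from [s] to [e]
    carries the small factor x^beta. Different weights on the components absorb this triangular
    part. *)

Definition poly := list (R * (nat * nat)).

(** Polynomials are used only through these linear functionals: [g] is a monomial for evaluation,
    [coef i j] for a coefficient, [weight] times a monomial for the derivative theta, [trunc N g]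
    for a partial sum. *)
Fixpoint psum (g : nat -> nat -> R) (l : poly) : R :=
  match l with
  | [] => 0
  | (c, (i, j)) :: t => c * g i j + psum g t
  end.

Definition monomial (x y : R) (i j : nat) : R := x ^ i * y ^ j.

Definition pabs (l : poly) : poly := map (fun t => (Rabs (fst t), snd t)) l.

(** A norm of the list: equal monomials are not merged, so it dominates the weighted l^1 norm of the
    polynomial. In return it is exactly additive under [++] and exactly multiplicative under
    [pmul]. *)
Definition pnorm (r s : R) (l : poly) : R := psum (monomial r s) (pabs l).

Definition pcst (c : R) : poly := [(c, (0, 0)%nat)].
Definition pX1 : poly := [(1, (1, 0)%nat)].
Definition pX2 : poly := [(1, (0, 1)%nat)].

Definition mmul (p q : R * (nat * nat)) : R * (nat * nat) :=
  (fst p * fst q,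
   ((fst (snd p) + fst (snd q))%nat, (snd (snd p) + snd (snd q))%nat)).

Definition pmul (a b : poly) : poly := flat_map (fun p => map (mmul p) b) a.

Fixpoint ppow (a : poly) (k : nat) : poly :=
  match k with O => pcst 1 | S k => pmul a (ppow a k) end.

Definition weight (beta : R) (i j : nat) : R := INR i + beta * INR j.

(* Inverse of [x d/dx + k] on the functions [x^i (x^beta)^j]. *)
Definition pinv (beta k : R) (l : poly) : poly :=
  map (fun t => (fst t / (weight beta (fst (snd t)) (snd (snd t)) + k), snd t)) l.

Definition nonconst (l : poly) : Prop :=
  Forall (fun t => (1 <= fst (snd t) + snd (snd t))%nat) l.

Lemma psum_app g a b : psum g (a ++ b) = psum g a + psum g b.
Proof.
  induction a as [|[c [i j]] a IH]; simpl; [ring | rewrite IH; ring].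
Qed.

Lemma psum_ext g h l : (forall i j, g i j = h i j) -> psum g l = psum h l.
Proof.
  intros E; induction l as [|[c [i j]] l IH]; simpl; [easy | now rewrite IH, E].
Qed.

Lemma psum_plus g h l :
  psum (fun i j => g i j + h i j) l = psum g l + psum h l.
Proof.
  induction l as [|[c [i j]] l IH]; simpl; [ring | rewrite IH; ring].
Qed.

Lemma psum_scal k g l : psum (fun i j => k * g i j) l = k * psum g l.
Proof.
  induction l as [|[c [i j]] l IH]; simpl; [ring | rewrite IH; ring].
Qed.

Lemma psum_map_mmul g c i j b :
  psum g (map (mmul (c, (i, j))) b)
  = c * psum (fun k l => g (i + k)%nat (j + l)%nat) b.
Proof.
  induction b as [|[c' [k l]] b IH]; simpl; [ring |].
  rewrite IH; ring.
Qed.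

Lemma psum_pmul g a b :
  psum g (pmul a b)
  = psum (fun i j => psum (fun k l => g (i + k)%nat (j + l)%nat) b) a.
Proof.
  induction a as [|[c [i j]] a IH]; [reflexivity |].
  cbn [pmul flat_map]. fold (pmul a b).
  rewrite psum_app, psum_map_mmul, IH. reflexivity.
Qed.

Lemma psum_pmul_app_l g a a' b :
  psum g (pmul (a ++ a') b) = psum g (pmul a b) + psum g (pmul a' b).
Proof. now rewrite !psum_pmul, psum_app. Qed.

Lemma psum_pmul_app_r g a b b' :
  psum g (pmul a (b ++ b')) = psum g (pmul a b) + psum g (pmul a b').
Proof.
  rewrite !psum_pmul, <- psum_plus.
  apply psum_ext; intros i j; apply psum_app.
Qed.

Lemma psum_pcst_pmul g c a : psum g (pmul (pcst c) a) = c * psum g a.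
Proof.
  rewrite psum_pmul; cbn [pcst psum].
  transitivity (c * psum g a + 0); [reflexivity | ring].
Qed.

Lemma psum_pinv g beta k l :
  psum g (pinv beta k l) = psum (fun i j => / (weight beta i j + k) * g i j) l.
Proof.
  induction l as [|[c [i j]] l IH]; [reflexivity |].
  cbn [pinv map psum fst snd]; fold (pinv beta k l).
  rewrite IH; unfold Rdiv; ring.
Qed.

Lemma eval_pmul x y a b :
  psum (monomial x y) (pmul a b)
  = psum (monomial x y) a * psum (monomial x y) b.
Proof.
  rewrite psum_pmul, Rmult_comm, <- psum_scal.
  apply psum_ext; intros i j.
  rewrite Rmult_comm, <- psum_scal; apply psum_ext; intros k l.
  unfold monomial; rewrite !pow_add; ring.
Qed.

Lemma eval_pcst x y c : psum (monomial x y) (pcst c) = c.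
Proof. unfold monomial; simpl; ring. Qed.

Lemma eval_pX1 x y : psum (monomial x y) pX1 = x.
Proof. unfold monomial; simpl; ring. Qed.

Lemma eval_pX2 x y : psum (monomial x y) pX2 = y.
Proof. unfold monomial; simpl; ring. Qed.

Lemma eval_ppow x y a k :
  psum (monomial x y) (ppow a k) = psum (monomial x y) a ^ k.
Proof.
  induction k as [|k IH]; [apply eval_pcst |].
  cbn [ppow]; now rewrite eval_pmul, IH.
Qed.

Lemma pabs_app a b : pabs (a ++ b) = pabs a ++ pabs b.
Proof. apply map_app. Qed.

Lemma pabs_pmul a b : pabs (pmul a b) = pmul (pabs a) (pabs b).
Proof.
  induction a as [|p a IH]; [reflexivity |].
  cbn [pmul flat_map pabs map]. fold (pmul a b). fold (pabs a).
  fold (pmul (pabs a) (pabs b)). fold (pabs (map (mmul p) b ++ pmul a b)).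
  rewrite pabs_app, IH; f_equal.
  unfold pabs; rewrite !map_map; apply map_ext; intros q.
  unfold mmul; simpl; now rewrite Rabs_mult.
Qed.

Lemma pabs_ppow a k : pabs (ppow a k) = ppow (pabs a) k.
Proof.
  induction k as [|k IH].
  - unfold ppow, pcst, pabs; simpl; now rewrite Rabs_R1.
  - cbn [ppow]; now rewrite pabs_pmul, IH.
Qed.

Lemma pnorm_app r s a b : pnorm r s (a ++ b) = pnorm r s a + pnorm r s b.
Proof. unfold pnorm; now rewrite pabs_app, psum_app. Qed.

Lemma pnorm_pmul r s a b : pnorm r s (pmul a b) = pnorm r s a * pnorm r s b.
Proof. unfold pnorm; now rewrite pabs_pmul, eval_pmul. Qed.

Lemma pnorm_pcst r s c : pnorm r s (pcst c) = Rabs c.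
Proof. unfold pnorm, monomial; simpl; ring. Qed.

Lemma pnorm_pX1 r s : pnorm r s pX1 = r.
Proof. unfold pnorm, monomial; simpl; rewrite Rabs_R1; ring. Qed.

Lemma pnorm_pX2 r s : pnorm r s pX2 = s.
Proof. unfold pnorm, monomial; simpl; rewrite Rabs_R1; ring. Qed.

Lemma monomial_nonneg r s i j : 0 <= r -> 0 <= s -> 0 <= monomial r s i j.
Proof. intros; unfold monomial; apply Rmult_le_pos; now apply pow_le. Qed.

Lemma monomial_le r s r' s' i j :
  0 <= r <= r' -> 0 <= s <= s' -> monomial r s i j <= monomial r' s' i j.
Proof.
  intros Hr Hs; unfold monomial.
  apply Rmult_le_compat; try (apply pow_le; lra); now apply pow_incr.
Qed.

Lemma Rabs_monomial x y i j :
  Rabs (monomial x y i j) = monomial (Rabs x) (Rabs y) i j.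
Proof. unfold monomial; now rewrite Rabs_mult, !RPow_abs. Qed.

Lemma psum_bound_nonconst g M r s l :
  (forall i j, (1 <= i + j)%nat -> Rabs (g i j) <= M * monomial r s i j) ->
  nonconst l -> Rabs (psum g l) <= M * pnorm r s l.
Proof.
  intros B Hl; induction Hl as [|[c [i j]] l Hc Hl IH]; unfold pnorm in *; simpl.
  - rewrite Rabs_R0; lra.
  - eapply Rle_trans; [apply Rabs_triang |].
    rewrite Rabs_mult, Rmult_plus_distr_l.
    apply Rplus_le_compat; [| exact IH].
    specialize (B i j Hc).
    apply Rle_trans with (Rabs c * (M * monomial r s i j)); [| right; ring].
    apply Rmult_le_compat_l; [apply Rabs_pos | exact B].
Qed.

Lemma psum_bound g M r s l :
  (forall i j, Rabs (g i j) <= M * monomial r s i j) ->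
  Rabs (psum g l) <= M * pnorm r s l.
Proof.
  intros B; induction l as [|[c [i j]] l IH]; unfold pnorm in *; simpl.
  - rewrite Rabs_R0; lra.
  - eapply Rle_trans; [apply Rabs_triang |].
    rewrite Rabs_mult, Rmult_plus_distr_l.
    apply Rplus_le_compat; [| exact IH].
    specialize (B i j).
    apply Rle_trans with (Rabs c * (M * monomial r s i j)); [| right; ring].
    apply Rmult_le_compat_l; [apply Rabs_pos | exact B].
Qed.

Lemma pnorm_nonneg r s l : 0 <= r -> 0 <= s -> 0 <= pnorm r s l.
Proof.
  intros Hr Hs; rewrite <- (Rmult_1_l (pnorm r s l)).
  eapply Rle_trans; [apply (Rabs_pos (psum (monomial r s) l)) |].
  apply psum_bound; intros i j.
  rewrite Rabs_right; [lra | apply Rle_ge, monomial_nonneg; lra].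
Qed.

Lemma pnorm_le r s r' s' l :
  0 <= r <= r' -> 0 <= s <= s' -> pnorm r s l <= pnorm r' s' l.
Proof.
  intros Hr Hs; induction l as [|[c [i j]] l IH]; unfold pnorm in *; simpl; [lra |].
  apply Rplus_le_compat; [| exact IH].
  apply Rmult_le_compat_l; [apply Rabs_pos | now apply monomial_le].
Qed.

Lemma nonconst_app a b : nonconst a -> nonconst b -> nonconst (a ++ b).
Proof. intros; apply Forall_app; now split. Qed.

Lemma nonconst_pmul_l a b : nonconst a -> nonconst (pmul a b).
Proof.
  intros Ha; apply Forall_flat_map.
  revert Ha; apply Forall_impl; intros p Hp.
  apply Forall_map, Forall_forall; intros q _; simpl; lia.
Qed.

Lemma nonconst_pmul_r a b : nonconst b -> nonconst (pmul a b).
Proof.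
  intros Hb; apply Forall_flat_map, Forall_forall; intros p _.
  apply Forall_map; revert Hb; apply Forall_impl; intros q Hq; simpl; lia.
Qed.

Lemma nonconst_pX1 : nonconst pX1.
Proof. repeat constructor. Qed.

Lemma nonconst_pX2 : nonconst pX2.
Proof. repeat constructor. Qed.

Lemma nonconst_pinv beta k l : nonconst l -> nonconst (pinv beta k l).
Proof.
  intros Hl; apply Forall_map; revert Hl; apply Forall_impl; now intros.
Qed.

(** The spectral gap of theta away from the constants: a factor [x1] contributes 1, a factor [x2]
    contributes beta. It allows theta itself, the case k = 0, to be inverted. *)
Lemma weight_ge beta gam i j :
  0 < beta -> gam <= 1 -> gam <= beta -> (1 <= i + j)%nat -> gam <= weight beta i j.
Proof.
  intros Hb H1 H2 Hij; unfold weight.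
  destruct i as [|i].
  - destruct j as [|j]; [lia |]; rewrite S_INR; simpl.
    assert (0 <= INR j) by apply pos_INR; nra.
  - rewrite S_INR; assert (0 <= INR j) by apply pos_INR.
    assert (0 <= INR i) by apply pos_INR; nra.
Qed.

(** The gain from inverting theta + k. The convenient lower bounds [q] used later are 1, 2 and
    [gam], for k = 1, 2 and 0. *)
Lemma pnorm_pinv beta gam k q r s l :
  0 < beta -> gam <= 1 -> gam <= beta -> 0 < q <= gam + k -> 0 <= r -> 0 <= s ->
  nonconst l -> pnorm r s (pinv beta k l) <= / q * pnorm r s l.
Proof.
  intros Hb H1 H2 Hq Hr Hs Hl; unfold pnorm.
  induction Hl as [|[c [i j]] l Hc Hl IH]; simpl; [lra |].
  rewrite Rmult_plus_distr_l; apply Rplus_le_compat; [| exact IH].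
  assert (W := weight_ge beta gam i j Hb H1 H2 Hc).
  unfold Rdiv; rewrite Rabs_mult, (Rabs_right (/ _)).
  2: apply Rle_ge, Rlt_le, Rinv_0_lt_compat; lra.
  rewrite Rmult_assoc.
  apply Rle_trans with (Rabs c * (/ q * monomial r s i j)); [| right; ring].
  apply Rmult_le_compat_l; [apply Rabs_pos |].
  apply Rmult_le_compat_r; [now apply monomial_nonneg |].
  apply Rinv_le_contravar; lra.
Qed.

(** Taylor expansion around [(p1, p2)], by substituting [p1 + x1] and [p2 + x2]. Analyticity near
    the origin asks for a power series at every nearby centre; the norm of the shifted list is the
    old norm at the enlarged radii. *)
Fixpoint pshift (p1 p2 : R) (l : poly) : poly :=
  match l with
  | [] => []
  | (c, (i, j)) :: t =>
      pmul (pcst c) (pmul (ppow (pcst p1 ++ pX1) i) (ppow (pcst p2 ++ pX2) j))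
      ++ pshift p1 p2 t
  end.

Lemma pshift_app p1 p2 a b : pshift p1 p2 (a ++ b) = pshift p1 p2 a ++ pshift p1 p2 b.
Proof.
  induction a as [|[c [i j]] a IH]; [reflexivity |].
  cbn [pshift app]; rewrite IH; apply app_assoc.
Qed.

Lemma eval_pshift p1 p2 x y l :
  psum (monomial x y) (pshift p1 p2 l) = psum (monomial (p1 + x) (p2 + y)) l.
Proof.
  induction l as [|[c [i j]] l IH]; [reflexivity |].
  cbn [pshift psum]; rewrite psum_app, IH; f_equal.
  now rewrite !eval_pmul, !eval_ppow, !psum_app, !eval_pcst, eval_pX1, eval_pX2.
Qed.

Lemma pnorm_pshift p1 p2 r s l :
  pnorm r s (pshift p1 p2 l) = pnorm (Rabs p1 + r) (Rabs p2 + s) l.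
Proof.
  induction l as [|[c [i j]] l IH]; [reflexivity |].
  cbn [pshift]; rewrite pnorm_app, IH; unfold pnorm at 3; simpl psum.
  unfold pnorm at 2; f_equal.
  rewrite !pnorm_pmul, pnorm_pcst; f_equal.
  unfold pnorm; rewrite !pabs_ppow, !eval_ppow.
  change (psum (monomial r s) (pabs ?l)) with (pnorm r s l).
  now rewrite !pnorm_app, !pnorm_pcst, pnorm_pX1, pnorm_pX2.
Qed.

(** * Series of polynomials and analyticity *)

Lemma geometric_limit (z : nat -> R) (C q : R) :
  0 <= q < 1 -> (forall k, Rabs (z (S k) - z k) <= C * q ^ k) ->
  is_lim_seq z (real (Lim_seq z)) /\
  forall k, Rabs (real (Lim_seq z) - z k) <= C * q ^ k / (1 - q).
Proof.
  intros Hq Hz.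
  assert (HC : 0 <= C).
  { assert (A := Hz O); simpl in A.
    assert (B := Rabs_pos (z 1%nat - z O)); lra. }
  (* The exact partial sum, with its factor 1 - q^p, is what the induction on [p] reproduces. *)
  assert (F : forall p k, Rabs (z (k + p)%nat - z k) <= C * q ^ k * (1 - q ^ p) / (1 - q)).
  { induction p as [|p IH]; intros k.
    - rewrite Nat.add_0_r, Rminus_diag, Rabs_R0; simpl; right; field; lra.
    - replace (k + S p)%nat with (S (k + p)) by lia.
      replace (z (S (k + p)) - z k)
        with ((z (S (k + p)) - z (k + p)%nat) + (z (k + p)%nat - z k)) by ring.
      eapply Rle_trans; [apply Rabs_triang |].
      eapply Rle_trans; [apply Rplus_le_compat; [apply Hz | apply IH] |].
      right; rewrite pow_add; simpl; field; lra. }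
  assert (F' : forall p k, Rabs (z (k + p)%nat - z k) <= C * q ^ k / (1 - q)).
  { intros p k; eapply Rle_trans; [apply F |].
    unfold Rdiv; apply Rmult_le_compat_r; [apply Rlt_le, Rinv_0_lt_compat; lra |].
    assert (0 <= q ^ p) by (apply pow_le; lra).
    assert (0 <= C * q ^ k) by (apply Rmult_le_pos; [lra | apply pow_le; lra]).
    nra. }
  assert (L0 : is_lim_seq (fun k => C * q ^ k / (1 - q)) 0).
  { apply is_lim_seq_ext with (fun k => (C / (1 - q)) * q ^ k).
    { intros k; field; lra. }
    replace (Finite 0) with (Rbar_mult (C / (1 - q)) 0) by (simpl; f_equal; ring).
    apply is_lim_seq_scal_l, is_lim_seq_geom; rewrite Rabs_right; lra. }
  assert (E : ex_finite_lim_seq z).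
  { apply ex_lim_seq_cauchy_corr; intros eps.
    apply is_lim_seq_spec in L0; destruct (L0 (pos_div_2 eps)) as [N HN].
    exists N.
    assert (G : forall k, (N <= k)%nat -> Rabs (z k - z N) < eps / 2).
    { intros k Hk; replace k with (N + (k - N))%nat by lia.
      eapply Rle_lt_trans; [apply F' |].
      specialize (HN N (Nat.le_refl N)); rewrite Rminus_0_r in HN.
      simpl in HN; apply Rle_lt_trans with (2 := HN), Rle_abs. }
    intros k l Hk Hl; assert (A := G k Hk); assert (B := G l Hl).
    replace (z k - z l) with ((z k - z N) - (z l - z N)) by ring.
    eapply Rle_lt_trans; [apply Rabs_triang |]; rewrite Rabs_Ropp; lra. }
  assert (L : is_lim_seq z (real (Lim_seq z))).
  { destruct E as [l Hl]; now rewrite (is_lim_seq_unique _ _ Hl). }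
  split; [exact L |]; intros k.
  refine (is_lim_seq_le (fun p => Rabs (z (k + p)%nat - z k))
            (fun _ => C * q ^ k / (1 - q)) (Rabs (real (Lim_seq z) - z k)) (C * q ^ k / (1 - q)) _ _ _).
  - intros p; apply F'.
  - apply (is_lim_seq_abs _ (Finite (real (Lim_seq z) - z k))).
    apply is_lim_seq_minus'; [| apply is_lim_seq_const].
    apply is_lim_seq_ext with (fun p => z (p + k)%nat).
    + intros p; f_equal; lia.
    + now apply is_lim_seq_incr_n.
  - apply is_lim_seq_const.
Qed.

(** * Coefficients, truncations and double series *)

Lemma is_lim_seq_sum_n (f : nat -> nat -> R) (l : nat -> R) N :
  (forall i, is_lim_seq (fun k => f k i) (l i)) ->
  is_lim_seq (fun k => sum_n (f k) N) (sum_n l N).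
Proof.
  intros F; induction N as [|N IH].
  - apply is_lim_seq_ext with (fun k => f k O); [intros k; now rewrite sum_O |].
    rewrite sum_O; apply F.
  - apply is_lim_seq_ext with (fun k => sum_n (f k) N + f k (S N)).
    { intros k; now rewrite sum_Sn. }
    rewrite sum_Sn; apply (is_lim_seq_plus' _ _ (sum_n l N) (l (S N))); auto.
Qed.

Lemma sum_n_le (f g : nat -> R) N :
  (forall i, f i <= g i) -> sum_n f N <= sum_n g N.
Proof.
  intros L; induction N as [|N IH]; [rewrite !sum_O; apply L |].
  rewrite !sum_Sn; apply Rplus_le_compat; auto.
Qed.

Lemma sum_n_nonneg (f : nat -> R) N : (forall i, 0 <= f i) -> 0 <= sum_n f N.
Proof.
  intros L; induction N as [|N IH]; [rewrite !sum_O; apply L |].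
  rewrite !sum_Sn; apply Rplus_le_le_0_compat; auto.
Qed.

Ltac real_eq := match goal with |- @eq _ ?a ?b => change (@eq R a b) end.

Definition coef (i j a b : nat) : R :=
  if (Nat.eqb a i && Nat.eqb b j)%bool then 1 else 0.

Definition trunc (N : nat) (g : nat -> nat -> R) (i j : nat) : R :=
  if (Nat.leb i N && Nat.leb j N)%bool then g i j else 0.

Lemma sum_n_indicator (f : nat -> R) a N :
  sum_n (fun i => f i * (if Nat.eqb a i then 1 else 0)) N
  = if Nat.leb a N then f a else 0.
Proof.
  induction N as [|N IH].
  - rewrite sum_O; destruct (Nat.eqb_spec a 0), (Nat.leb_spec a 0); subst; try lia; real_eq; ring.
  - rewrite sum_Sn, IH; unfold plus; simpl.
    destruct (Nat.eqb_spec a (S N)), (Nat.leb_spec a (S N)), (Nat.leb_spec a N);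
      subst; try lia; real_eq; ring.
Qed.

(** Makes a square partial sum of the double series a single functional of the polynomial, so that
    the uniform estimates for functionals apply to it. *)
Lemma psum_trunc N g l :
  psum (trunc N g) l
  = sum_n (fun i => sum_n (fun j => g i j * psum (coef i j) l) N) N.
Proof.
  induction l as [|[c [a b]] l IH]; simpl.
  - rewrite (sum_n_ext _ (fun _ => 0)).
    + rewrite sum_n_const; real_eq; ring.
    + intros i; rewrite (sum_n_ext _ (fun _ => 0)); [| intros; real_eq; ring].
      rewrite sum_n_const; real_eq; ring.
  - rewrite IH.
    assert (E : c * trunc N g a b
      = sum_n (fun i => sum_n (fun j => g i j * (c * coef i j a b)) N) N).
    { rewrite (sum_n_ext _ (fun i =>
        (c * (if Nat.leb b N then g i b else 0)) * (if Nat.eqb a i then 1 else 0))).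
      - rewrite (sum_n_indicator (fun i => c * (if Nat.leb b N then g i b else 0))).
        unfold trunc; destruct (Nat.leb a N), (Nat.leb b N); simpl; real_eq; ring.
      - intros i; rewrite (sum_n_ext _ (fun j =>
          (c * g i j * (if Nat.eqb a i then 1 else 0)) * (if Nat.eqb b j then 1 else 0))).
        + rewrite (sum_n_indicator (fun j => c * g i j * (if Nat.eqb a i then 1 else 0))).
          destruct (Nat.leb b N); real_eq; ring.
        + intros j; unfold coef.
          destruct (Nat.eqb a i), (Nat.eqb b j); simpl; real_eq; ring. }
    rewrite E, <- (sum_n_plus (G := R_AbelianMonoid)).
    apply sum_n_ext; intros i.
    rewrite <- (sum_n_plus (G := R_AbelianMonoid)); apply sum_n_ext; intros j.
    unfold plus; simpl; real_eq; ring.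
Qed.

Fixpoint pconcat (D : nat -> poly) (k : nat) : poly :=
  match k with O => [] | S k => pconcat D k ++ D k end.

(** Every functional dominated by the monomials at [(r, s)] converges along the partial sums, with
    an error depending on [g] only through [M]. This uniformity later allows limits to be
    interchanged. *)
Lemma pconcat_limit D r s C q g M :
  0 <= r -> 0 <= s -> 0 <= q < 1 -> 0 <= M ->
  (forall k, pnorm r s (D k) <= C * q ^ k) ->
  (forall i j, Rabs (g i j) <= M * monomial r s i j) ->
  let z k := psum g (pconcat D k) in
  is_lim_seq z (real (Lim_seq z)) /\
  forall k, Rabs (real (Lim_seq z) - z k) <= M * C * q ^ k / (1 - q).
Proof.
  intros Hr Hs Hq HM HD Hg z.
  apply (geometric_limit z (M * C) q Hq); intros k; unfold z; simpl.
  rewrite psum_app.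
  replace (_ + _ - _) with (psum g (D k)) by ring.
  eapply Rle_trans; [apply (psum_bound g M r s); exact Hg |].
  rewrite Rmult_assoc; now apply Rmult_le_compat_l.
Qed.

Lemma psum_trunc_eventually g l :
  exists N0, forall N, (N0 <= N)%nat -> psum (trunc N g) l = psum g l.
Proof.
  induction l as [|[c [i j]] l [N0 IH]]; [now exists O |].
  exists (max N0 (max i j)); intros N HN; simpl.
  rewrite IH by lia; f_equal; unfold trunc.
  destruct (Nat.leb_spec i N), (Nat.leb_spec j N); simpl; try lia; reflexivity.
Qed.

Lemma pnorm_pconcat D r s C q k :
  0 <= q < 1 -> (forall k, pnorm r s (D k) <= C * q ^ k) ->
  pnorm r s (pconcat D k) <= C * (1 - q ^ k) / (1 - q).
Proof.
  intros Hq HD; induction k as [|k IH]; simpl.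
  - unfold pnorm; simpl; right; field; lra.
  - rewrite pnorm_app; eapply Rle_trans; [apply Rplus_le_compat; [apply IH | apply HD] |].
    right; field; lra.
Qed.

Lemma double_series_of_geometric D r s C q :
  0 < r -> 0 < s -> 0 <= q < 1 ->
  (forall k, pnorm r s (D k) <= C * q ^ k) ->
  exists a : nat -> nat -> R, forall x y, Rabs x <= r -> Rabs y <= s ->
    is_abs_double_series (fun i j => a i j * x ^ i * y ^ j)
      (real (Lim_seq (fun k => psum (monomial x y) (pconcat D k)))).
Proof.
  intros Hr Hs Hq HD.
  (* The coefficients of the limit are the limits of the coefficients; [coef i j] is dominated with
     constant [/ monomial r s i j], by Cauchy's estimate. *)
  set (a := fun i j => real (Lim_seq (fun k => psum (coef i j) (pconcat D k)))).
  assert (La : forall i j, is_lim_seq (fun k => psum (coef i j) (pconcat D k)) (a i j)).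
  { intros i j.
    assert (P : 0 < monomial r s i j)
      by (unfold monomial; apply Rmult_lt_0_compat; now apply pow_lt).
    refine (proj1 (pconcat_limit D r s C q (coef i j) (/ monomial r s i j)
      (Rlt_le _ _ Hr) (Rlt_le _ _ Hs) Hq _ HD _)).
    - now apply Rlt_le, Rinv_0_lt_compat.
    - intros i' j'; unfold coef.
      destruct (Nat.eqb_spec i' i), (Nat.eqb_spec j' j); subst; simpl;
        rewrite ?Rabs_R0, ?Rabs_R1.
      1: right; field; lra.
      all: apply Rmult_le_pos; [now apply Rlt_le, Rinv_0_lt_compat | apply monomial_nonneg; lra]. }
  assert (LT : forall N g, is_lim_seq (fun k => psum (trunc N g) (pconcat D k))
    (sum_n (fun i => sum_n (fun j => g i j * a i j) N) N)).
  { intros N g.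
    apply is_lim_seq_ext with (fun k =>
      sum_n (fun i => sum_n (fun j => g i j * psum (coef i j) (pconcat D k)) N) N).
    { intros k; now rewrite psum_trunc. }
    apply (is_lim_seq_sum_n (fun k i => sum_n (fun j => g i j * psum (coef i j) (pconcat D k)) N)
      (fun i => sum_n (fun j => g i j * a i j) N)); intros i.
    apply (is_lim_seq_sum_n (fun k j => g i j * psum (coef i j) (pconcat D k))
      (fun j => g i j * a i j)); intros j.
    apply (is_lim_seq_scal_l _ (g i j) (Finite (a i j))), La. }
  assert (BT : forall N g x y, (forall i j, Rabs (g i j) <= monomial x y i j) ->
    forall i j, Rabs (trunc N g i j) <= 1 * monomial x y i j).
  { intros N g x y Hg i j; unfold trunc; rewrite Rmult_1_l.
    destruct (Nat.leb i N && Nat.leb j N)%bool; [apply Hg |].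
    rewrite Rabs_R0; eapply Rle_trans; [apply Rabs_pos | apply Hg]. }
  assert (HC : 0 <= C).
  { assert (A := HD O); simpl in A.
    assert (B := pnorm_nonneg r s (D O) (Rlt_le _ _ Hr) (Rlt_le _ _ Hs)); lra. }
  assert (SA : forall N,
    sum_n (fun i => sum_n (fun j => monomial r s i j * Rabs (a i j)) N) N <= C / (1 - q)).
  { intros N.
    (* Giving the monomial the sign of [a i j] turns the sum of absolute values into a linear
       functional, bounded through the norms. *)
    set (g := fun i j => if Rle_dec 0 (a i j) then monomial r s i j else - monomial r s i j).
    assert (Hg : forall i j, Rabs (g i j) <= monomial r s i j).
    { intros i j; assert (0 <= monomial r s i j) by (apply monomial_nonneg; lra).
      unfold g; destruct (Rle_dec 0 (a i j)); rewrite ?Rabs_Ropp, Rabs_right; lra. }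
    rewrite (sum_n_ext _ (fun i => sum_n (fun j => g i j * a i j) N)).
    2:{ intros i; apply sum_n_ext; intros j; unfold g.
        destruct (Rle_dec 0 (a i j)); [rewrite Rabs_right | rewrite Rabs_left]; lra. }
    refine (is_lim_seq_le (fun k => psum (trunc N g) (pconcat D k)) (fun _ => C / (1 - q))
      _ (C / (1 - q)) _ (LT N g) (is_lim_seq_const _)).
    intros k; eapply Rle_trans; [apply Rle_abs |].
    eapply Rle_trans; [apply (psum_bound _ 1 r s), BT, Hg |].
    rewrite Rmult_1_l; eapply Rle_trans; [apply pnorm_pconcat with (1 := Hq) (2 := HD) |].
    unfold Rdiv; apply Rmult_le_compat_r; [apply Rlt_le, Rinv_0_lt_compat; lra |].
    assert (0 <= q ^ k) by (apply pow_le; lra); nra. }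
  exists a; intros x y Hx Hy; split.
  - apply ex_finite_lim_seq_incr with (C / (1 - q)).
    + intros N; rewrite sum_Sn.
      rewrite <- (Rplus_0_r (sum_n _ N)) at 1.
      apply Rplus_le_compat; [| apply sum_n_nonneg; intros; apply Rabs_pos].
      apply sum_n_le; intros i; rewrite sum_Sn.
      rewrite <- (Rplus_0_r (sum_n _ N)) at 1.
      apply Rplus_le_compat; [apply Rle_refl | apply Rabs_pos].
    + intros N; eapply Rle_trans; [| apply (SA N)].
      apply sum_n_le; intros i; apply sum_n_le; intros j.
      rewrite !Rabs_mult, Rmult_assoc, Rmult_comm.
      apply Rmult_le_compat_r; [apply Rabs_pos |].
      rewrite <- Rabs_mult; change (x ^ i * y ^ j) with (monomial x y i j).
      rewrite Rabs_monomial; apply monomial_le; split; auto; apply Rabs_pos.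
  - set (g := monomial x y).
    assert (Hg : forall i j, Rabs (g i j) <= monomial r s i j).
    { intros i j; unfold g; rewrite Rabs_monomial.
      apply monomial_le; split; auto; apply Rabs_pos. }
    assert (Hr' := Rlt_le _ _ Hr); assert (Hs' := Rlt_le _ _ Hs).
    destruct (pconcat_limit D r s C q g 1 Hr' Hs' Hq Rle_0_1 HD) as [_ V].
    { intros; rewrite Rmult_1_l; apply Hg. }
    set (v := real (Lim_seq (fun k => psum g (pconcat D k)))) in *.
    apply is_lim_seq_spec; intros eps.
    assert (L0 : is_lim_seq (fun k => 1 * C * q ^ k / (1 - q)) 0).
    { apply is_lim_seq_ext with (fun k => (C / (1 - q)) * q ^ k).
      { intros k; field; lra. }
      replace (Finite 0) with (Rbar_mult (C / (1 - q)) 0) by (simpl; f_equal; ring).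
      apply is_lim_seq_scal_l, is_lim_seq_geom; rewrite Rabs_right; lra. }
    (* Interchange of the limits in [k] and [N]: [k] is fixed first, with an error uniform in [N],
       and then [N] is taken beyond the degrees of the polynomial [pconcat D k]. *)
    apply is_lim_seq_spec in L0; destruct (L0 (pos_div_2 eps)) as [k Hk].
    specialize (Hk k (Nat.le_refl k)); rewrite Rminus_0_r in Hk; simpl in Hk.
    apply Rle_lt_trans with (1 := Rle_abs _) in Hk.
    destruct (psum_trunc_eventually g (pconcat D k)) as [N0 HN0].
    exists N0; intros N HN; specialize (HN0 N HN).
    destruct (pconcat_limit D r s C q (trunc N g) 1 Hr' Hs' Hq Rle_0_1 HD) as [_ T].
    { intros; now apply BT. }
    specialize (T k); specialize (V k).
    rewrite (is_lim_seq_unique _ _ (LT N g)), HN0 in T; simpl real in T.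
    rewrite (sum_n_ext _ (fun i => sum_n (fun j => g i j * a i j) N)).
    2:{ intros i; apply sum_n_ext; intros j; unfold g, monomial; simpl; ring. }
    set (w := sum_n _ N) in *.
    replace (w - v) with ((w - psum g (pconcat D k)) - (v - psum g (pconcat D k))) by ring.
    eapply Rle_lt_trans; [apply Rabs_triang |]; rewrite Rabs_Ropp; lra.
Qed.

Lemma pconcat_pshift D p1 p2 k :
  pconcat (fun k => pshift p1 p2 (D k)) k = pshift p1 p2 (pconcat D k).
Proof.
  induction k as [|k IH]; simpl; [easy |]; now rewrite pshift_app, IH.
Qed.

Lemma analytic_near_of_geometric D r s C q :
  0 < r -> 0 < s -> 0 <= q < 1 ->
  (forall k, pnorm r s (D k) <= C * q ^ k) ->
  analytic_near
    (fun x y => real (Lim_seq (fun k => psum (monomial x y) (pconcat D k)))) 0 0.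
Proof.
  intros Hr Hs Hq HD.
  (* Half of the radii is spent on moving the centre, the other half remains as radius of
     convergence there. *)
  assert (Hd : 0 < Rmin r s / 2) by (apply Rdiv_lt_0_compat; [now apply Rmin_pos | lra]).
  exists (mkposreal _ Hd); simpl; intros p1 p2 Hp1 Hp2.
  rewrite Rminus_0_r in Hp1, Hp2.
  assert (M1 := Rmin_l r s); assert (M2 := Rmin_r r s).
  destruct (double_series_of_geometric (fun k => pshift p1 p2 (D k)) (r / 2) (s / 2) C q)
    as [a Ha]; try lra.
  { intros k; rewrite pnorm_pshift; eapply Rle_trans; [| apply (HD k)].
    apply pnorm_le; assert (A := Rabs_pos p1); assert (B := Rabs_pos p2); lra. }
  exists a, (mkposreal _ Hd); simpl; intros x y Hx Hy.
  assert (Hx' : Rabs (x - p1) <= r / 2) by lra.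
  assert (Hy' : Rabs (y - p2) <= s / 2) by lra.
  specialize (Ha _ _ Hx' Hy').
  rewrite (Lim_seq_ext _ (fun k => psum (monomial x y) (pconcat D k))) in Ha; [exact Ha |].
  intros k; rewrite pconcat_pshift, eval_pshift.
  now replace (p1 + (x - p1)) with x by ring; replace (p2 + (y - p2)) with y by ring.
Qed.

(** * The Picard iteration *)

Record state := State { cy : poly; ce : poly; ca : poly; cs : poly; cu : poly }.

Definition state0 : state := State [] [] [] [] [].

Definition state_app (Y D : state) : state :=
  State (cy Y ++ cy D) (ce Y ++ ce D) (ca Y ++ ca D) (cs Y ++ cs D) (cu Y ++ cu D).

(** The right-hand sides of the system, with theta + 1, theta + 2, theta and theta inverted in the
    last four components. [pinv beta 0] would divide by 0 at the monomial 1; iterates from 0 never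
    produce that monomial in its argument. *)
Definition phi (m n beta sig : R) (Y : state) : state :=
  State
    (pmul pX1 (pcst 1 ++ cy Y))
    (pinv beta 1
       (pmul (pcst (-1)) (pmul (ca Y) (ce Y))
        ++ pmul (pcst (- sig)) (pmul pX2 (pcst 1 ++ cs Y))
        ++ pmul (pcst (- m)) (pmul (cy Y) (pcst 2 ++ ca Y))))
    (pinv beta 2
       (ce Y ++ pmul (pcst (-1)) (pmul (ca Y) (ca Y))
        ++ pmul (pcst m) (pmul (cy Y) (pcst 2 ++ ca Y))))
    (pinv beta 0
       (pmul (pcst (-1))
          (pmul (pmul (pcst n) (ca Y) ++ cy Y) (pcst 1 ++ cs Y))))
    (pinv beta 0 (pmul (ca Y) (pcst 1 ++ cu Y))).

(* The increment [phi (Y + D) - phi Y], expanded so that no cancellation occurs;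
   [Y'] stands for [Y + D]. *)
Definition dphi (m n beta sig : R) (Y Y' D : state) : state :=
  State
    (pmul pX1 (cy D))
    (pinv beta 1
       (pmul (pcst (-1)) (pmul (ca D) (ce Y') ++ pmul (ca Y) (ce D))
        ++ pmul (pcst (- sig)) (pmul pX2 (cs D))
        ++ pmul (pcst (- m)) (pmul (cy D) (pcst 2 ++ ca Y') ++ pmul (cy Y) (ca D))))
    (pinv beta 2
       (ce D ++ pmul (pcst (-1)) (pmul (ca D) (ca Y') ++ pmul (ca Y) (ca D))
        ++ pmul (pcst m) (pmul (cy D) (pcst 2 ++ ca Y') ++ pmul (cy Y) (ca D))))
    (pinv beta 0
       (pmul (pcst (-1))
          (pmul (pmul (pcst n) (ca D) ++ cy D) (pcst 1 ++ cs Y')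
           ++ pmul (pmul (pcst n) (ca Y) ++ cy Y) (cs D))))
    (pinv beta 0 (pmul (ca D) (pcst 1 ++ cu Y') ++ pmul (ca Y) (cu D))).

(** The increment is carried along as a list of its own, because its decay could not be read off
    from the norm of a formal difference of two iterates. *)
Fixpoint iter (m n beta sig : R) (k : nat) : state * state :=
  match k with
  | O => (state0, phi m n beta sig state0)
  | S k =>
      let (Y, D) := iter m n beta sig k in
      let Y' := state_app Y D in (Y', dphi m n beta sig Y Y' D)
  end.

Definition Yk m n beta sig k := fst (iter m n beta sig k).
Definition Dk m n beta sig k := snd (iter m n beta sig k).

Lemma Yk_S m n beta sig k :
  Yk m n beta sig (S k) = state_app (Yk m n beta sig k) (Dk m n beta sig k).
Proof. unfold Yk, Dk; simpl; now destruct (iter m n beta sig k). Qed.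

Lemma Dk_S m n beta sig k :
  Dk m n beta sig (S k)
  = dphi m n beta sig (Yk m n beta sig k) (Yk m n beta sig (S k)) (Dk m n beta sig k).
Proof. unfold Yk, Dk; simpl; now destruct (iter m n beta sig k). Qed.

Lemma cu_Yk m n beta sig k :
  cu (Yk m n beta sig k) = pconcat (fun k => cu (Dk m n beta sig k)) k.
Proof.
  induction k as [|k IH]; [reflexivity |].
  rewrite Yk_S; cbn [cu state_app pconcat]; now rewrite IH.
Qed.

(** Equality as polynomials: expanding a product permutes and regroups the monomials of a list,
    which no functional [psum g] sees. *)
Definition peq (a b : poly) : Prop := forall g, psum g a = psum g b.

Record state_eq (Y Z : state) : Prop := {
  eq_y : peq (cy Y) (cy Z); eq_e : peq (ce Y) (ce Z); eq_a : peq (ca Y) (ca Z);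
  eq_s : peq (cs Y) (cs Z); eq_u : peq (cu Y) (cu Z) }.

Lemma psum_pcst_pmul_pmul g c a b :
  psum g (pmul (pmul (pcst c) a) b) = c * psum g (pmul a b).
Proof. now rewrite !(psum_pmul _ _ b), psum_pcst_pmul. Qed.

Ltac expand_psum :=
  repeat rewrite ?psum_pinv, ?psum_app, ?psum_pcst_pmul, ?psum_pmul_app_l,
    ?psum_pmul_app_r, ?psum_pcst_pmul_pmul.

Lemma phi_app m n beta sig Y D :
  state_eq (phi m n beta sig (state_app Y D))
    (state_app (phi m n beta sig Y) (dphi m n beta sig Y (state_app Y D) D)).
Proof.
  split; intros g; cbn [phi dphi state_app cy ce ca cs cu]; expand_psum; ring.
Qed.

(** Adding up the expanded increments telescopes to the Picard iteration. Size estimates use the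
    increments; coefficients and the comparison with [H] use this form. *)
Lemma Yk_phi m n beta sig k :
  state_eq (Yk m n beta sig (S k)) (phi m n beta sig (Yk m n beta sig k)).
Proof.
  induction k as [|k IH]; [split; intros g; reflexivity |].
  rewrite (Yk_S m n beta sig (S k)), Dk_S.
  assert (A := phi_app m n beta sig (Yk m n beta sig k) (Dk m n beta sig k)).
  rewrite <- Yk_S in A.
  destruct IH as [I1 I2 I3 I4 I5], A as [A1 A2 A3 A4 A5].
  split; intros g; cbn [state_app cy ce ca cs cu] in *; rewrite psum_app;
    [rewrite A1, I1 | rewrite A2, I2 | rewrite A3, I3 | rewrite A4, I4 | rewrite A5, I5];
    cbn [state_app cy ce ca cs cu]; now rewrite psum_app.
Qed.

Record state_nonconst (Y : state) : Prop := {
  nc_y : nonconst (cy Y); nc_e : nonconst (ce Y); nc_a : nonconst (ca Y);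
  nc_s : nonconst (cs Y); nc_u : nonconst (cu Y) }.

Ltac nonconst_tac :=
  repeat first
    [ assumption
    | match goal with
      | |- nonconst pX1 => apply nonconst_pX1
      | |- nonconst pX2 => apply nonconst_pX2
      | |- nonconst (_ ++ _) => apply nonconst_app
      | |- nonconst (pinv _ _ _) => apply nonconst_pinv
      | |- nonconst (pmul (pcst _) _) => apply nonconst_pmul_r
      | |- nonconst (pmul _ _) => apply nonconst_pmul_l
      end ].

Lemma state_nonconst_app Y D :
  state_nonconst Y -> state_nonconst D -> state_nonconst (state_app Y D).
Proof. intros [] []; split; cbn [state_app cy ce ca cs cu]; nonconst_tac. Qed.

Lemma phi_nonconst m n beta sig Y :
  state_nonconst Y -> state_nonconst (phi m n beta sig Y).
Proof. intros []; split; cbn [phi cy ce ca cs cu]; nonconst_tac. Qed.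

Lemma dphi_nonconst m n beta sig Y Y' D :
  state_nonconst Y -> state_nonconst D -> state_nonconst (dphi m n beta sig Y Y' D).
Proof. intros [] []; split; cbn [dphi cy ce ca cs cu]; nonconst_tac. Qed.

Lemma iter_nonconst m n beta sig k :
  state_nonconst (Yk m n beta sig k) /\ state_nonconst (Dk m n beta sig k).
Proof.
  assert (Z : state_nonconst state0) by (split; constructor).
  induction k as [|k [IY ID]]; [split; [exact Z | now apply phi_nonconst] |].
  rewrite Dk_S; split.
  - rewrite Yk_S; now apply state_nonconst_app.
  - now apply dphi_nonconst.
Qed.

(* [phi] contracts in the norm giving the components y, e, a, s, u the weights
   [1 / del], 1, 1, [1 / K], [1 / K]: [K] is large because [s] and [u] are driven by [a]
   without a small factor, [del] small because [y] enters the equations for [e] and [a]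
   with the factor [m]. *)
Record small_params (m n gam sig K del Rb r s : R) : Prop := {
  sp_m : 0 <= m; sp_n : 0 < n; sp_gam : 0 < gam <= 1; sp_sig : 0 < sig;
  sp_K : K = 4 * (n + 2) / gam;
  sp_del : del = / (16 * (m + 1));
  sp_R : Rb = / (2 * K + 8);
  sp_r : 0 < r <= del * Rb / 4;
  sp_s : 0 < s; sp_ss : sig * s <= Rb / 4 }.

Record state_bound (r s K del mu : R) (Y : state) : Prop := {
  sb_y : pnorm r s (cy Y) <= del * mu; sb_e : pnorm r s (ce Y) <= mu;
  sb_a : pnorm r s (ca Y) <= mu; sb_s : pnorm r s (cs Y) <= K * mu;
  sb_u : pnorm r s (cu Y) <= K * mu }.

(** The last five fields bound the Lipschitz constants of the components of [phi] on the ball of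
    radius [Rb]: the rate 3/4 is required of each, relative to its weight. *)
Record contraction_consts (m n gam sig K del Rb r s : R) : Prop := {
  cc_K : 0 < K; cc_del : 0 < del; cc_R : 0 < Rb;
  cc_y : r <= 3 / 4;
  cc_e : 2 * Rb + sig * s * K + m * (del * (2 + Rb) + del * Rb) <= 3 / 4;
  cc_a : / 2 * (1 + 2 * Rb + m * (del * (2 + Rb) + del * Rb)) <= 3 / 4;
  cc_s : / gam * ((n + del) * (1 + K * Rb) + (n * Rb + del * Rb) * K) <= 3 / 4 * K;
  cc_u : / gam * ((1 + K * Rb) + Rb * K) <= 3 / 4 * K }.

(** * Contraction estimates *)

Lemma small_params_contraction m n gam sig K del Rb r s :
  small_params m n gam sig K del Rb r s ->
  contraction_consts m n gam sig K del Rb r s.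
Proof.
  intros [Hm Hn Hg Hsig HK Hdel HR Hr Hs Hss].
  assert (K0 : 0 < K) by (rewrite HK; apply Rdiv_lt_0_compat; lra).
  assert (d0 : 0 < del) by (rewrite Hdel; apply Rinv_0_lt_compat; lra).
  assert (R0 : 0 < Rb) by (rewrite HR; apply Rinv_0_lt_compat; lra).
  (* [Rb] is made for [K * Rb <= / 2] and [Rb <= / 8], and [del] for [m * del <= / 16]. By the
     choice of [K], the bound [3 / 4 * K] wanted for [s] and [u] equals [3 * (n + 2) / gam]. *)
  assert (RK : Rb * (2 * K + 8) = 1) by (rewrite HR; field; lra).
  assert (dm : del * (16 * (m + 1)) = 1) by (rewrite Hdel; field; lra).
  assert (KR : K * Rb <= / 2) by nra.
  assert (R8 : Rb <= / 8) by nra.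
  assert (md : 0 <= m * del <= / 16) by nra.
  assert (d1 : del <= / 16) by nra.
  assert (mm : m * (del * (2 + Rb) + del * Rb) <= / 4).
  { replace (m * (del * (2 + Rb) + del * Rb)) with ((m * del) * (2 + 2 * Rb)) by ring; nra. }
  assert (Kg : / gam * (n + 2) = K / 4) by (rewrite HK; field; lra).
  assert (g0 : 0 < / gam) by (apply Rinv_0_lt_compat; lra).
  split; try assumption.
  - nra.
  - assert (sig * s * K <= / 8) by nra. lra.
  - lra.
  - apply Rle_trans with (/ gam * (3 * (n + 2))); [| lra].
    apply Rmult_le_compat_l; [lra |].
    replace ((n + del) * (1 + K * Rb) + (n * Rb + del * Rb) * K)
      with ((n + del) * (1 + 2 * (K * Rb))) by ring; nra.
  - apply Rle_trans with (/ gam * (3 * (n + 2))); [| lra].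
    apply Rmult_le_compat_l; [lra |]; nra.
Qed.

Ltac mono :=
  repeat first
    [ assumption | lra
    | match goal with
      | |- _ + _ <= _ + _ => apply Rplus_le_compat
      | |- 0 <= _ + _ => apply Rplus_le_le_0_compat
      | |- 0 <= _ * _ => apply Rmult_le_pos
      | |- _ * _ <= _ * _ => apply Rmult_le_compat
      end ].

(** Stated for plain numbers because it is applied twice: to norms of increments of the iteration,
    and to absolute values at a point [x] of the differences between the functions coming from [H]
    and an iterate. Primes mark the second argument of a product difference, a' e' - a e = (a' - a)
    e' + a (e' - e). *)
Lemma contraction_step m n gam sig K del Rb r s mu
  (X1 X2 dy de da ds du y a e' a' s' u' : R) :
  contraction_consts m n gam sig K del Rb r s ->
  0 <= m -> 0 < n -> 0 < gam -> 0 < sig -> 0 <= mu ->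
  0 <= X1 <= r -> 0 <= X2 <= s ->
  0 <= dy <= del * mu -> 0 <= de <= mu -> 0 <= da <= mu ->
  0 <= ds <= K * mu -> 0 <= du <= K * mu ->
  0 <= y <= del * Rb -> 0 <= a <= Rb ->
  0 <= e' <= Rb -> 0 <= a' <= Rb -> 0 <= s' <= K * Rb -> 0 <= u' <= K * Rb ->
  X1 * dy <= del * (3 / 4 * mu) /\
  da * e' + a * de + sig * (X2 * ds) + m * (dy * (2 + a') + y * da) <= 3 / 4 * mu /\
  / 2 * (de + (da * a' + a * da) + m * (dy * (2 + a') + y * da)) <= 3 / 4 * mu /\
  / gam * ((n * da + dy) * (1 + s') + (n * a + y) * ds) <= K * (3 / 4 * mu) /\
  / gam * (da * (1 + u') + a * du) <= K * (3 / 4 * mu).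
Proof.
  intros [K0 d0 R0 Cy Ce Ca Cs Cu] Hm Hn Hg Hs Hmu HX1 HX2 Hdy Hde Hda Hds Hdu
    Hy Ha He' Ha' Hs' Hu'.
  assert (g0 : 0 < / gam) by (apply Rinv_0_lt_compat; lra).
  assert (dm0 : 0 <= del * mu) by (apply Rmult_le_pos; lra).
  assert (M : m * (dy * (2 + a') + y * da)
    <= m * ((del * mu) * (2 + Rb) + (del * Rb) * mu)) by mono.
  repeat split.
  - apply Rle_trans with (r * (del * mu)); [mono |].
    apply Rle_trans with (3 / 4 * (del * mu)); [mono | lra].
  - apply Rle_trans with
      (mu * Rb + Rb * mu + sig * (s * (K * mu)) + m * ((del * mu) * (2 + Rb) + (del * Rb) * mu)).
    + mono.
    + apply Rle_trans with (mu * (2 * Rb + sig * s * K + m * (del * (2 + Rb) + del * Rb)));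
        [right; ring | rewrite (Rmult_comm (3 / 4)); now apply Rmult_le_compat_l].
  - apply Rle_trans with
      (/ 2 * (mu + (mu * Rb + Rb * mu) + m * ((del * mu) * (2 + Rb) + (del * Rb) * mu))).
    + mono.
    + apply Rle_trans with (mu * (/ 2 * (1 + 2 * Rb + m * (del * (2 + Rb) + del * Rb))));
        [right; ring | rewrite (Rmult_comm (3 / 4)); now apply Rmult_le_compat_l].
  - apply Rle_trans with
      (/ gam * ((n * mu + del * mu) * (1 + K * Rb) + (n * Rb + del * Rb) * (K * mu))).
    + mono.
    + apply Rle_trans with
        (mu * (/ gam * ((n + del) * (1 + K * Rb) + (n * Rb + del * Rb) * K)));
        [right; ring |].
      replace (K * (3 / 4 * mu)) with (mu * (3 / 4 * K)) by ring.
      now apply Rmult_le_compat_l.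
  - apply Rle_trans with (/ gam * (mu * (1 + K * Rb) + Rb * (K * mu))).
    + mono.
    + apply Rle_trans with (mu * (/ gam * ((1 + K * Rb) + Rb * K))); [right; ring |].
      replace (K * (3 / 4 * mu)) with (mu * (3 / 4 * K)) by ring.
      now apply Rmult_le_compat_l.
Qed.

Ltac expand_pnorm :=
  repeat rewrite ?pnorm_app, ?pnorm_pmul, ?pnorm_pcst, ?pnorm_pX1, ?pnorm_pX2.

Lemma dphi_bound m n beta gam sig K del Rb r s mu Y Y' D :
  small_params m n gam sig K del Rb r s -> 0 < beta -> gam <= beta -> 0 <= mu ->
  state_nonconst Y -> state_nonconst D ->
  state_bound r s K del Rb Y -> state_bound r s K del Rb Y' ->
  state_bound r s K del mu D ->
  state_bound r s K del (3 / 4 * mu) (dphi m n beta sig Y Y' D).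
Proof.
  intros SP Hb Hgb Hmu NY ND BY BY' BD.
  assert (CC := small_params_contraction _ _ _ _ _ _ _ _ _ SP).
  assert (ND' := dphi_nonconst m n beta sig Y Y' D NY ND).
  destruct SP as [Hm Hn Hg Hsig HK Hdel HR Hr Hs Hss].
  assert (N0 : forall l, 0 <= pnorm r s l) by (intros; apply pnorm_nonneg; lra).
  destruct BY as [Y1 Y2 Y3 Y4 Y5], BY' as [Z1 Z2 Z3 Z4 Z5], BD as [D1 D2 D3 D4 D5].
  edestruct (contraction_step m n gam sig K del Rb r s mu r s
    (pnorm r s (cy D)) (pnorm r s (ce D)) (pnorm r s (ca D)) (pnorm r s (cs D))
    (pnorm r s (cu D)) (pnorm r s (cy Y)) (pnorm r s (ca Y))
    (pnorm r s (ce Y')) (pnorm r s (ca Y')) (pnorm r s (cs Y')) (pnorm r s (cu Y')))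
    as [E1 [E2 [E3 [E4 E5]]]];
    [eassumption | assumption | assumption | lra | assumption | assumption
    | lra | lra | split; auto .. |].
  destruct NY as [N1 N2 N3 N4 N5], ND as [M1 M2 M3 M4 M5].
  assert (A1 : Rabs (-1) = 1) by (rewrite Rabs_left; lra).
  assert (A2 : Rabs 2 = 2) by (rewrite Rabs_right; lra).
  assert (A3 : Rabs (- sig) = sig) by (rewrite Rabs_left; lra).
  assert (A4 : Rabs (- m) = m) by (rewrite Rabs_Ropp, Rabs_right; lra).
  assert (A5 : Rabs m = m) by (rewrite Rabs_right; lra).
  assert (A6 : Rabs n = n) by (rewrite Rabs_right; lra).
  split; cbn [dphi cy ce ca cs cu].
  - expand_pnorm; lra.
  - eapply Rle_trans;
      [apply pnorm_pinv with (gam := gam) (q := 1); try lra; nonconst_tac |].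
    expand_pnorm; rewrite A1, A2, A3, A4; lra.
  - eapply Rle_trans;
      [apply pnorm_pinv with (gam := gam) (q := 2); try lra; nonconst_tac |].
    expand_pnorm; rewrite A1, A2, A5; lra.
  - eapply Rle_trans;
      [apply pnorm_pinv with (gam := gam) (q := gam); try lra; nonconst_tac |].
    expand_pnorm; rewrite A1, A6, Rabs_R1; lra.
  - eapply Rle_trans;
      [apply pnorm_pinv with (gam := gam) (q := gam); try lra; nonconst_tac |].
    expand_pnorm; rewrite Rabs_R1; lra.
Qed.

Lemma phi0_bound m n beta gam sig K del Rb r s :
  small_params m n gam sig K del Rb r s -> 0 < beta -> gam <= beta ->
  state_bound r s K del (Rb / 4) (phi m n beta sig state0).
Proof.
  intros SP Hb Hgb.
  assert (CC := small_params_contraction _ _ _ _ _ _ _ _ _ SP).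
  destruct SP as [Hm Hn Hg Hsig HK Hdel HR Hr Hs Hss].
  destruct CC as [K0 d0 R0 _ _ _ _ _].
  assert (P0 : forall l, l = [] -> pnorm r s l = 0) by (intros l ->; reflexivity).
  assert (KR : 0 <= K * (Rb / 4)) by (apply Rmult_le_pos; lra).
  assert (A3 : Rabs (- sig) = sig) by (rewrite Rabs_left; lra).
  split; cbn [phi state0 cy ce ca cs cu].
  - expand_pnorm; rewrite Rabs_R1, (P0 []) by reflexivity; lra.
  - eapply Rle_trans;
      [apply pnorm_pinv with (gam := gam) (q := 1); try lra; nonconst_tac;
        try apply nonconst_pmul_r; constructor |].
    expand_pnorm; rewrite A3, Rabs_R1, (P0 []) by reflexivity; lra.
  - eapply Rle_trans;
      [apply pnorm_pinv with (gam := gam) (q := 2); try lra; nonconst_tac;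
        constructor |].
    expand_pnorm; rewrite (P0 []) by reflexivity; lra.
  - eapply Rle_trans;
      [apply pnorm_pinv with (gam := gam) (q := gam); try lra; nonconst_tac;
        constructor |].
    expand_pnorm; rewrite (P0 []) by reflexivity; lra.
  - eapply Rle_trans;
      [apply pnorm_pinv with (gam := gam) (q := gam); try lra; nonconst_tac;
        constructor |].
    expand_pnorm; rewrite (P0 []) by reflexivity; lra.
Qed.

(** The first increment has size [Rb / 4], whence the bounds imposed on [r] and [sig * s]. With
    ratio 3/4 the increments add up to at most [Rb], so the iterates stay in the ball on which the
    map contracts. *)
Lemma iter_bound m n beta gam sig K del Rb r s k :
  small_params m n gam sig K del Rb r s -> 0 < beta -> gam <= beta ->
  state_bound r s K del (Rb * (1 - (3 / 4) ^ k)) (Yk m n beta sig k) /\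
  state_bound r s K del (Rb / 4 * (3 / 4) ^ k) (Dk m n beta sig k).
Proof.
  intros SP Hb Hgb.
  assert (CC := small_params_contraction _ _ _ _ _ _ _ _ _ SP).
  assert (K0 := cc_K _ _ _ _ _ _ _ _ _ CC); assert (d0 := cc_del _ _ _ _ _ _ _ _ _ CC).
  assert (R0 := cc_R _ _ _ _ _ _ _ _ _ CC).
  assert (W : forall nu Z, nu <= Rb -> state_bound r s K del nu Z -> state_bound r s K del Rb Z).
  { intros nu Z Hnu []; split; eapply Rle_trans; eauto; apply Rmult_le_compat_l; lra. }
  assert (Q : forall j, 0 <= (3 / 4) ^ j) by (intros; apply pow_le; lra).
  assert (QR : forall j, Rb * (1 - (3 / 4) ^ j) <= Rb) by (intros j; specialize (Q j); nra).
  induction k as [|k [IY ID]].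
  - rewrite !pow_O, Rminus_diag, Rmult_0_r, Rmult_1_r; split.
    + split; unfold pnorm; simpl; lra.
    + now apply phi0_bound with gam.
  - assert (IS : state_bound r s K del (Rb * (1 - (3 / 4) ^ S k)) (Yk m n beta sig (S k))).
    { rewrite Yk_S; destruct IY, ID; split; cbn [state_app cy ce ca cs cu];
        rewrite pnorm_app; simpl pow; lra. }
    split; [exact IS |]; rewrite Dk_S.
    replace (Rb / 4 * (3 / 4) ^ S k) with (3 / 4 * (Rb / 4 * (3 / 4) ^ k)) by (simpl; ring).
    destruct (iter_nonconst m n beta sig k) as [NY ND].
    eapply dphi_bound; eauto.
    apply Rmult_le_pos; [lra | apply Q].
Qed.

(** * Low-order coefficients *)

Lemma coef_nonconst l : nonconst l -> psum (coef 0 0) l = 0.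
Proof.
  induction 1 as [|[c [i j]] l Hc Hl IH]; simpl in *; [easy |].
  rewrite IH; unfold coef; destruct i, j; simpl; try lia; ring.
Qed.

Lemma coef_pinv i j beta k l :
  psum (coef i j) (pinv beta k l) = psum (coef i j) l / (weight beta i j + k).
Proof.
  rewrite psum_pinv; unfold Rdiv; rewrite Rmult_comm, <- psum_scal.
  apply psum_ext; intros a b; unfold coef.
  destruct (Nat.eqb_spec a i), (Nat.eqb_spec b j); subst; simpl; ring.
Qed.

Lemma psum_zero l : psum (fun _ _ => 0) l = 0.
Proof. induction l as [|[c [i j]] l IH]; simpl; [easy | rewrite IH; ring]. Qed.

(** [T] is a finite splitting of [g] over sums of exponents. For [g = coef i j] it lists the ways to
    write [(i, j)] as a sum, and the lemma becomes the Cauchy product. *)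
Lemma psum_linear_pmul g (T : list ((nat -> nat -> R) * (nat -> nat -> R))) a b :
  (forall i j k l, g (i + k)%nat (j + l)%nat
     = fold_right (fun t acc => fst t i j * snd t k l + acc) 0 T) ->
  psum g (pmul a b)
  = fold_right (fun t acc => psum (fst t) a * psum (snd t) b + acc) 0 T.
Proof.
  intros E; rewrite psum_pmul.
  transitivity (psum (fun i j =>
    fold_right (fun t acc => fst t i j * psum (snd t) b + acc) 0 T) a).
  - apply psum_ext; intros i j.
    rewrite (psum_ext _ _ b (E i j)); clear E.
    induction T as [|t T IH]; simpl.
    + apply psum_zero.
    + now rewrite psum_plus, psum_scal, IH.
  - clear E; induction T as [|t T IH]; simpl.
    + apply psum_zero.
    + rewrite psum_plus, IH; f_equal.
      rewrite Rmult_comm, <- psum_scal; apply psum_ext; intros; ring.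
Qed.

Ltac coef_cases :=
  intros [|[|i]] [|[|j]] [|[|k]] [|[|l]]; unfold coef; simpl; ring.

Lemma coef00_pmul a b :
  psum (coef 0 0) (pmul a b) = psum (coef 0 0) a * psum (coef 0 0) b.
Proof.
  rewrite (psum_linear_pmul _ [(coef 0 0, coef 0 0)]); [simpl; ring | coef_cases].
Qed.

Lemma coef10_pmul a b :
  psum (coef 1 0) (pmul a b)
  = psum (coef 1 0) a * psum (coef 0 0) b + psum (coef 0 0) a * psum (coef 1 0) b.
Proof.
  rewrite (psum_linear_pmul _ [(coef 1 0, coef 0 0); (coef 0 0, coef 1 0)]);
    [simpl; ring | coef_cases].
Qed.

Lemma coef01_pmul a b :
  psum (coef 0 1) (pmul a b)
  = psum (coef 0 1) a * psum (coef 0 0) b + psum (coef 0 0) a * psum (coef 0 1) b.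
Proof.
  rewrite (psum_linear_pmul _ [(coef 0 1, coef 0 0); (coef 0 0, coef 0 1)]);
    [simpl; ring | coef_cases].
Qed.

Lemma coef11_pmul a b :
  psum (coef 1 1) (pmul a b)
  = psum (coef 1 1) a * psum (coef 0 0) b + psum (coef 0 0) a * psum (coef 1 1) b
    + psum (coef 1 0) a * psum (coef 0 1) b + psum (coef 0 1) a * psum (coef 1 0) b.
Proof.
  rewrite (psum_linear_pmul _ [(coef 1 1, coef 0 0); (coef 0 0, coef 1 1);
    (coef 1 0, coef 0 1); (coef 0 1, coef 1 0)]); [simpl; ring | coef_cases].
Qed.

Lemma coef_pcst i j c :
  psum (coef i j) (pcst c) = c * coef i j 0 0.
Proof. simpl; ring. Qed.

Lemma coef_pX1 i j : psum (coef i j) pX1 = coef i j 1 0.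
Proof. simpl; ring. Qed.

Lemma coef_pX2 i j : psum (coef i j) pX2 = coef i j 0 1.
Proof. simpl; ring. Qed.

Lemma Yk_coef00 m n beta sig k :
  let c := psum (coef 0 0) in let S := Yk m n beta sig k in
  c (cy S) = 0 /\ c (ce S) = 0 /\ c (ca S) = 0 /\ c (cs S) = 0 /\ c (cu S) = 0.
Proof.
  destruct (iter_nonconst m n beta sig k) as [[] _].
  repeat split; now apply coef_nonconst.
Qed.

Lemma coef_eval i j a b :
  coef i j a b = if (Nat.eqb a i && Nat.eqb b j)%bool then 1 else 0.
Proof. reflexivity. Qed.

Ltac coef_step m n beta sig k :=
  destruct (Yk_coef00 m n beta sig k) as [Z1 [Z2 [Z3 [Z4 Z5]]]];
  cbn [phi cy ce ca cs cu];
  repeat rewrite ?coef_pinv, ?psum_app, ?psum_pcst_pmul, ?coef00_pmul, ?coef10_pmul,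
    ?coef01_pmul, ?coef11_pmul, ?coef_pcst, ?coef_pX1, ?coef_pX2;
  rewrite ?Z1, ?Z2, ?Z3, ?Z4, ?Z5;
  rewrite ?(coef_eval _ _ 0 0), ?(coef_eval _ _ 0 1), ?(coef_eval _ _ 1 0);
  unfold weight; cbn [Nat.eqb andb INR].

(** Low-order coefficients become stationary after finitely many iterations. The successors count
    how long a source takes along the chain [y], [e], [a], [u]; the source [x2] enters at [e]. *)
Lemma coef10_y m n beta sig k : psum (coef 1 0) (cy (Yk m n beta sig (S k))) = 1.
Proof. rewrite (eq_y _ _ (Yk_phi m n beta sig k)); coef_step m n beta sig k; ring. Qed.

Lemma coef01_y m n beta sig k : psum (coef 0 1) (cy (Yk m n beta sig k)) = 0.
Proof.
  destruct k as [|k]; [reflexivity |].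
  rewrite (eq_y _ _ (Yk_phi m n beta sig k)); coef_step m n beta sig k; ring.
Qed.

Lemma coef10_e m n beta sig k :
  psum (coef 1 0) (ce (Yk m n beta sig (S (S k)))) = - m.
Proof.
  rewrite (eq_e _ _ (Yk_phi m n beta sig (S k))); coef_step m n beta sig (S k).
  rewrite coef10_y; field.
Qed.

Lemma coef01_e m n beta sig k : 0 < beta ->
  psum (coef 0 1) (ce (Yk m n beta sig (S k))) = - sig / (beta + 1).
Proof.
  intros Hb; rewrite (eq_e _ _ (Yk_phi m n beta sig k)); coef_step m n beta sig k.
  rewrite coef01_y; field; lra.
Qed.

Lemma coef10_a m n beta sig k :
  psum (coef 1 0) (ca (Yk m n beta sig (S (S (S k))))) = m / 3.
Proof.
  rewrite (eq_a _ _ (Yk_phi m n beta sig _)); coef_step m n beta sig (S (S k)).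
  rewrite coef10_y, coef10_e; field.
Qed.

Lemma coef01_a m n beta sig k : 0 < beta ->
  psum (coef 0 1) (ca (Yk m n beta sig (S (S k))))
  = - sig / ((beta + 1) * (beta + 2)).
Proof.
  intros Hb; rewrite (eq_a _ _ (Yk_phi m n beta sig _)); coef_step m n beta sig (S k).
  rewrite coef01_y, coef01_e by easy; field; lra.
Qed.

Lemma coef01_u m n beta sig k : 0 < beta ->
  psum (coef 0 1) (cu (Yk m n beta sig (S (S (S k)))))
  = - sig / (beta * (beta + 1) * (beta + 2)).
Proof.
  intros Hb; rewrite (eq_u _ _ (Yk_phi m n beta sig _)); coef_step m n beta sig (S (S k)).
  rewrite coef01_a by easy; field; lra.
Qed.

Lemma coef10_u m n beta sig k :
  psum (coef 1 0) (cu (Yk m n beta sig (S (S (S (S k)))))) = m / 3.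
Proof.
  rewrite (eq_u _ _ (Yk_phi m n beta sig _)); coef_step m n beta sig (S (S (S k))).
  rewrite coef10_a; field.
Qed.

(** For m = 0 the coefficient of [x1] vanishes in [e], [a] and [u]. The variable [x1] then acts only
    through the factor 1 - x inside [s], which is multiplied by [x2] in the equation for [e]; so
    [x1 * x2] is the first monomial to detect it. *)
Lemma coef10_e0 n beta sig k : psum (coef 1 0) (ce (Yk 0 n beta sig k)) = 0.
Proof.
  destruct k as [|k]; [reflexivity |].
  rewrite (eq_e _ _ (Yk_phi 0 n beta sig k)); coef_step 0 n beta sig k; field.
Qed.

Lemma coef10_a0 n beta sig k : psum (coef 1 0) (ca (Yk 0 n beta sig k)) = 0.
Proof.
  destruct k as [|k]; [reflexivity |].
  rewrite (eq_a _ _ (Yk_phi 0 n beta sig k)); coef_step 0 n beta sig k.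
  rewrite coef10_e0; field.
Qed.

Lemma coef10_u0 n beta sig k : psum (coef 1 0) (cu (Yk 0 n beta sig k)) = 0.
Proof.
  destruct k as [|k]; [reflexivity |].
  rewrite (eq_u _ _ (Yk_phi 0 n beta sig k)); coef_step 0 n beta sig k.
  rewrite coef10_a0; field.
Qed.

Lemma coef10_s0 n beta sig k :
  psum (coef 1 0) (cs (Yk 0 n beta sig (S (S k)))) = -1.
Proof.
  rewrite (eq_s _ _ (Yk_phi 0 n beta sig _)); coef_step 0 n beta sig (S k).
  rewrite coef10_a0, coef10_y; field.
Qed.

Lemma coef11_e0 n beta sig k : 0 < beta ->
  psum (coef 1 1) (ce (Yk 0 n beta sig (S (S (S k))))) = sig / (beta + 2).
Proof.
  intros Hb; rewrite (eq_e _ _ (Yk_phi 0 n beta sig _)).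
  coef_step 0 n beta sig (S (S k)).
  rewrite coef10_a0, coef10_e0, coef10_s0; field; lra.
Qed.

Lemma coef11_a0 n beta sig k : 0 < beta ->
  psum (coef 1 1) (ca (Yk 0 n beta sig (S (S (S (S k))))))
  = sig / ((beta + 2) * (beta + 3)).
Proof.
  intros Hb; rewrite (eq_a _ _ (Yk_phi 0 n beta sig _)).
  coef_step 0 n beta sig (S (S (S k))).
  rewrite coef10_a0, coef11_e0 by easy; field; lra.
Qed.

Lemma coef11_u0 n beta sig k : 0 < beta ->
  psum (coef 1 1) (cu (Yk 0 n beta sig (S (S (S (S (S k)))))))
  = sig / ((beta + 1) * (beta + 2) * (beta + 3)).
Proof.
  intros Hb; rewrite (eq_u _ _ (Yk_phi 0 n beta sig _)).
  coef_step 0 n beta sig (S (S (S (S k)))).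
  rewrite coef10_a0, coef10_u0, coef11_a0 by easy; field; lra.
Qed.

(** * Non-degeneracy of the limit *)

Definition plim (D : nat -> poly) (x y : R) : R :=
  real (Lim_seq (fun k => psum (monomial x y) (pconcat D k))).

Record geometric (D : nat -> poly) (r s C q : R) : Prop := {
  ge_r : 0 < r; ge_s : 0 < s; ge_q : 0 <= q < 1; ge_C : 0 <= C;
  ge_nonconst : forall k, nonconst (D k);
  ge_bound : forall k, pnorm r s (D k) <= C * q ^ k }.

Lemma nonconst_pconcat D k : (forall k, nonconst (D k)) -> nonconst (pconcat D k).
Proof.
  intros H; induction k as [|k IH]; [constructor | now apply nonconst_app].
Qed.

Lemma plim_spec D r s C q x y :
  geometric D r s C q -> Rabs x <= r -> Rabs y <= s ->
  is_lim_seq (fun k => psum (monomial x y) (pconcat D k)) (plim D x y).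
Proof.
  intros [Hr Hs Hq HC HN HB] Hx Hy.
  refine (proj1 (pconcat_limit D r s C q (monomial x y) 1
    (Rlt_le _ _ Hr) (Rlt_le _ _ Hs) Hq Rle_0_1 HB _)).
  intros i j; rewrite Rmult_1_l, Rabs_monomial.
  apply monomial_le; split; auto; apply Rabs_pos.
Qed.

Lemma plim_00 D r s C q : geometric D r s C q -> plim D 0 0 = 0.
Proof.
  intros G; unfold plim.
  rewrite (Lim_seq_ext _ (fun _ => 0)), Lim_seq_const; [easy |]; intros k.
  assert (N := nonconst_pconcat D k (ge_nonconst _ _ _ _ _ G)).
  induction N as [|[c [i j]] l Hc Hl IH]; simpl in *; [easy |].
  rewrite IH; unfold monomial; destruct i, j; simpl; try lia; ring.
Qed.

(** Uniform in [k], and linear in [M]: a functional that is small of order t^p on non-constant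
    monomials has values of order t^p, also in the limit. *)
Lemma psum_pconcat_bound D r s C q g M k :
  geometric D r s C q -> 0 <= M ->
  (forall i j, (1 <= i + j)%nat -> Rabs (g i j) <= M * monomial r s i j) ->
  Rabs (psum g (pconcat D k)) <= M * (C / (1 - q)).
Proof.
  intros [Hr Hs Hq HC HN HB] HM Hg.
  eapply Rle_trans; [apply (psum_bound_nonconst g M r s _ Hg), nonconst_pconcat, HN |].
  apply Rmult_le_compat_l; [easy |].
  eapply Rle_trans; [apply pnorm_pconcat with (1 := Hq) (2 := HB) |].
  unfold Rdiv; apply Rmult_le_compat_r; [apply Rlt_le, Rinv_0_lt_compat; lra |].
  assert (0 <= q ^ k) by (apply pow_le; lra); nra.
Qed.

Lemma lim_seq_abs_le (u : nat -> R) (l c B : R) k0 :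
  is_lim_seq u l -> (forall k, (k0 <= k)%nat -> Rabs (u k - c) <= B) -> Rabs (l - c) <= B.
Proof.
  intros L H.
  refine (is_lim_seq_le_loc (fun k => Rabs (u k - c)) (fun _ => B) (Rabs (l - c)) B _ _ _).
  - exists k0; exact H.
  - apply (is_lim_seq_abs _ (Finite (l - c))).
    apply is_lim_seq_minus'; [exact L | apply is_lim_seq_const].
  - apply is_lim_seq_const.
Qed.

Lemma pow_le_pow t a b : 0 <= t <= 1 -> (b <= a)%nat -> 0 <= t ^ a <= t ^ b.
Proof.
  intros Ht Hab; split; [apply pow_le; lra |].
  replace a with (b + (a - b))%nat by lia; rewrite pow_add.
  assert (0 <= t ^ b) by (apply pow_le; lra).
  assert (t ^ (a - b) <= 1) by (rewrite <- (pow1 (a - b)); apply pow_incr; lra).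
  nra.
Qed.

Lemma monomial_scaled r s t i j :
  monomial (r * t) (s * t) i j = t ^ (i + j) * monomial r s i j.
Proof. unfold monomial; rewrite !Rpow_mult_distr, pow_add; ring. Qed.

Lemma scaled_bound r s t a b i j :
  0 < r -> 0 < s -> 0 <= t <= 1 -> (b <= a)%nat ->
  Rabs (t ^ a * monomial r s i j) <= t ^ b * monomial r s i j.
Proof.
  intros Hr Hs Ht Hab; assert (P := pow_le_pow t a b Ht Hab).
  assert (Q : 0 <= monomial r s i j) by (apply monomial_nonneg; lra).
  rewrite Rabs_right; [nra | apply Rle_ge, Rmult_le_pos; lra].
Qed.

Lemma zero_bound r s t b i j :
  0 < r -> 0 < s -> 0 <= t <= 1 -> Rabs 0 <= t ^ b * monomial r s i j.
Proof.
  intros; rewrite Rabs_R0; apply Rmult_le_pos; [apply pow_le; lra | apply monomial_nonneg; lra].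
Qed.

(** After subtraction of its linear part, evaluation at [(r * t, 0)] is a functional that kills
    every non-constant monomial except x1^i with i >= 2, where it gains t^i <= t^2. *)
Lemma plim_expansion_fst D r s C q c k0 :
  geometric D r s C q ->
  (forall k, (k0 <= k)%nat -> psum (coef 1 0) (pconcat D k) = c) ->
  forall t, 0 <= t <= 1 ->
    Rabs (plim D (r * t) 0 - c * r * t ^ 1) <= t ^ 2 * (C / (1 - q)).
Proof.
  intros G Hc t Ht; assert (Hr := ge_r _ _ _ _ _ G); assert (Hs := ge_s _ _ _ _ _ G).
  apply lim_seq_abs_le with (fun k => psum (monomial (r * t) 0) (pconcat D k)) k0.
  - apply plim_spec with (1 := G); [rewrite Rabs_right; nra | rewrite Rabs_R0; lra].
  - intros k Hk; rewrite <- (Hc k Hk).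
    replace (psum (monomial (r * t) 0) (pconcat D k)
             - psum (coef 1 0) (pconcat D k) * r * t ^ 1)
      with (psum (fun i j => monomial (r * t) 0 i j + - (r * t) * coef 1 0 i j) (pconcat D k))
      by (rewrite psum_plus, psum_scal; ring).
    apply psum_pconcat_bound with (1 := G); [apply pow_le; lra |]; intros i j Hij.
    destruct j as [|j].
    + destruct i as [|[|i]]; [lia | |].
      * replace (_ + _) with 0 by (unfold monomial, coef; simpl; ring).
        now apply zero_bound.
      * replace (_ + _) with (t ^ S (S i) * monomial r s (S (S i)) 0).
        -- apply scaled_bound; auto; lia.
        -- unfold monomial, coef; rewrite Rpow_mult_distr; cbn [Nat.eqb andb pow]; ring.
    + replace (_ + _) with 0.
      * now apply zero_bound.
      * unfold monomial, coef; rewrite (Bool.andb_false_intro2 _ (Nat.eqb (S j) 0)) by easy.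
        rewrite pow_i by lia; ring.
Qed.

Lemma plim_expansion_snd D r s C q c k0 :
  geometric D r s C q ->
  (forall k, (k0 <= k)%nat -> psum (coef 0 1) (pconcat D k) = c) ->
  forall t, 0 <= t <= 1 ->
    Rabs (plim D 0 (s * t) - c * s * t ^ 1) <= t ^ 2 * (C / (1 - q)).
Proof.
  intros G Hc t Ht; assert (Hr := ge_r _ _ _ _ _ G); assert (Hs := ge_s _ _ _ _ _ G).
  apply lim_seq_abs_le with (fun k => psum (monomial 0 (s * t)) (pconcat D k)) k0.
  - apply plim_spec with (1 := G); [rewrite Rabs_R0; lra | rewrite Rabs_right; nra].
  - intros k Hk; rewrite <- (Hc k Hk).
    replace (psum (monomial 0 (s * t)) (pconcat D k)
             - psum (coef 0 1) (pconcat D k) * s * t ^ 1)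
      with (psum (fun i j => monomial 0 (s * t) i j + - (s * t) * coef 0 1 i j) (pconcat D k))
      by (rewrite psum_plus, psum_scal; ring).
    apply psum_pconcat_bound with (1 := G); [apply pow_le; lra |]; intros i j Hij.
    destruct i as [|i].
    + destruct j as [|[|j]]; [lia | |].
      * replace (_ + _) with 0 by (unfold monomial, coef; simpl; ring).
        now apply zero_bound.
      * replace (_ + _) with (t ^ S (S j) * monomial r s 0 (S (S j))).
        -- apply scaled_bound; auto; lia.
        -- unfold monomial, coef; rewrite Rpow_mult_distr; cbn [Nat.eqb andb pow]; ring.
    + replace (_ + _) with 0.
      * now apply zero_bound.
      * unfold monomial, coef; rewrite pow_i by lia; cbn [Nat.eqb andb]; ring.
Qed.

(** The second difference removes the pure powers of either variable. Among the monomials divisible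
    by [x1 * x2], subtracting the one with i = j = 1 leaves total degree at least 3. *)
Lemma plim_expansion_mixed D r s C q c k0 :
  geometric D r s C q ->
  (forall k, (k0 <= k)%nat -> psum (coef 1 1) (pconcat D k) = c) ->
  forall t, 0 <= t <= 1 ->
    Rabs (plim D (r * t) (s * t) - plim D (r * t) 0 - plim D 0 (s * t)
          - c * (r * s) * t ^ 2) <= t ^ 3 * (C / (1 - q)).
Proof.
  intros G Hc t Ht; assert (Hr := ge_r _ _ _ _ _ G); assert (Hs := ge_s _ _ _ _ _ G).
  apply lim_seq_abs_le with (fun k => psum (monomial (r * t) (s * t)) (pconcat D k)
    - psum (monomial (r * t) 0) (pconcat D k) - psum (monomial 0 (s * t)) (pconcat D k)) k0.
  - apply is_lim_seq_minus'; [apply is_lim_seq_minus' |];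
      apply plim_spec with (1 := G); rewrite ?Rabs_R0, ?Rabs_right; nra.
  - intros k Hk; rewrite <- (Hc k Hk).
    replace (_ - _) with
      (psum (fun i j => monomial (r * t) (s * t) i j + (-1 * monomial (r * t) 0 i j
        + (-1 * monomial 0 (s * t) i j + - (r * s * t ^ 2) * coef 1 1 i j))) (pconcat D k))
      by (rewrite !psum_plus, !psum_scal; ring).
    apply psum_pconcat_bound with (1 := G); [apply pow_le; lra |]; intros i j Hij.
    rewrite monomial_scaled.
    destruct i as [|i].
    + destruct j as [|j]; [lia |].
      replace (_ + _) with 0; [now apply zero_bound |].
      unfold monomial, coef; cbn [Nat.eqb andb Nat.add]; rewrite !Rpow_mult_distr.
      rewrite (pow_i (S j)) by lia; simpl; ring.
    + destruct j as [|j].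
      * replace (_ + _) with 0; [now apply zero_bound |].
        unfold monomial, coef; rewrite Nat.add_0_r.
        rewrite (Bool.andb_false_intro2 _ (Nat.eqb 0 1)) by easy.
        rewrite !Rpow_mult_distr, (pow_i (S i)) by lia; simpl; ring.
      * destruct (Nat.eq_dec (i + j) 0) as [E|E].
        -- assert (i = O /\ j = O) as [-> ->] by lia.
           replace (_ + _) with 0; [now apply zero_bound |].
           unfold monomial, coef; simpl; ring.
        -- replace (_ + _) with (t ^ (S i + S j) * monomial r s (S i) (S j)).
           ++ apply scaled_bound; auto; lia.
           ++ unfold coef.
              replace (Nat.eqb (S i) 1 && Nat.eqb (S j) 1)%bool with false.
              ** unfold monomial; rewrite !(pow_i (S _)) by lia; ring.
              ** destruct i, j; simpl; try easy; lia.
Qed.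

Lemma nonzero_of_expansion (f : R -> R) (c B : R) p :
  c <> 0 -> (forall t, 0 <= t <= 1 -> Rabs (f t - c * t ^ p) <= t ^ S p * B) ->
  forall eps, 0 < eps -> exists t, 0 < t < eps /\ t <= 1 /\ f t <> 0.
Proof.
  intros Hc Hf eps Heps.
  assert (Hc' : 0 < Rabs c) by now apply Rabs_pos_lt.
  assert (HB : 0 <= B).
  { assert (A := Hf 1 ltac:(lra)); rewrite !pow1 in A.
    assert (P := Rabs_pos (f 1 - c * 1)); lra. }
  (* If [f t] vanished, the expansion would give [Rabs c <= t * B]; the third bound on [t] excludes
     this, with [B + 1] guarding against [B = 0]. *)
  set (t := Rmin 1 (Rmin (eps / 2) (Rabs c / (2 * (B + 1))))).
  assert (Hq : 0 < Rabs c / (2 * (B + 1))) by (apply Rdiv_lt_0_compat; lra).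
  assert (t0 : 0 < t) by (unfold t; repeat apply Rmin_pos; lra).
  assert (t1 : t <= 1) by apply Rmin_l.
  assert (t2 : t <= eps / 2)
    by (eapply Rle_trans; [apply Rmin_r | apply Rmin_l]).
  assert (t3 : t <= Rabs c / (2 * (B + 1)))
    by (eapply Rle_trans; [apply Rmin_r | apply Rmin_r]).
  exists t; repeat split; try lra; intros E.
  specialize (Hf t ltac:(lra)); rewrite E, Rminus_0_l, Rabs_Ropp, Rabs_mult in Hf.
  assert (tp : 0 < t ^ p) by now apply pow_lt.
  rewrite (Rabs_right (t ^ p)) in Hf by lra; simpl in Hf.
  assert (L : t * (2 * (B + 1)) <= Rabs c).
  { apply Rmult_le_compat_r with (r := 2 * (B + 1)) in t3; [| lra].
    replace (Rabs c / (2 * (B + 1)) * (2 * (B + 1))) with (Rabs c) in t3 by (field; lra).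
    exact t3. }
  assert (Rabs c <= t * B); [| nra].
  apply Rmult_le_reg_r with (t ^ p); [easy |]; lra.
Qed.

Lemma small_scaled r t (eps : posreal) :
  0 < r -> 0 < t -> t < eps / r -> Rabs (r * t - 0) < eps.
Proof.
  intros Hr Ht Hte; rewrite Rminus_0_r, Rabs_right by nra.
  apply Rmult_lt_compat_l with (r := r) in Hte; [| easy].
  now replace (r * (eps / r)) with (pos eps) in Hte by (field; lra).
Qed.

Lemma plim_nonconstant_snd D r s C q c k0 :
  geometric D r s C q -> c <> 0 ->
  (forall k, (k0 <= k)%nat -> psum (coef 0 1) (pconcat D k) = c) ->
  ~ locally_2d (fun x1 x2 => plim D x1 x2 = 0) 0 0 /\ depends_on_snd (plim D).
Proof.
  intros G Hc Hk; assert (Hs := ge_s _ _ _ _ _ G).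
  assert (E := plim_expansion_snd D r s C q c k0 G Hk).
  assert (cs : c * s <> 0) by (apply Rmult_integral_contrapositive; split; lra).
  assert (F : forall eps : posreal, exists x, Rabs (x - 0) < eps /\ plim D 0 x <> 0).
  { intros eps.
    destruct (nonzero_of_expansion (fun t => plim D 0 (s * t)) (c * s) _ 1 cs E (eps / s))
      as [t [Ht [_ Hv]]].
    - apply Rdiv_lt_0_compat; [apply cond_pos | easy].
    - exists (s * t); split; [now apply small_scaled | exact Hv]. }
  split; intros [eps L]; destruct (F eps) as [x [Hx Hv]]; apply Hv;
    assert (Z : Rabs (0 - 0) < eps) by (rewrite Rminus_0_r, Rabs_R0; apply cond_pos).
  - now apply L.
  - rewrite (L 0 x Z Hx); now apply plim_00 with (1 := G).
Qed.

Lemma plim_depends_fst D r s C q c k0 :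
  geometric D r s C q -> c <> 0 ->
  (forall k, (k0 <= k)%nat -> psum (coef 1 0) (pconcat D k) = c) ->
  depends_on_fst (plim D).
Proof.
  intros G Hc Hk [eps L]; assert (Hr := ge_r _ _ _ _ _ G).
  assert (E := plim_expansion_fst D r s C q c k0 G Hk).
  assert (cr : c * r <> 0) by (apply Rmult_integral_contrapositive; split; lra).
  destruct (nonzero_of_expansion (fun t => plim D (r * t) 0) (c * r) _ 1 cr E (eps / r))
    as [t [Ht [_ Hv]]].
  - apply Rdiv_lt_0_compat; [apply cond_pos | easy].
  - apply Hv; rewrite L; [now apply plim_00 with (1 := G) | now apply small_scaled |].
    rewrite Rminus_0_r, Rabs_R0; apply cond_pos.
Qed.

(** Were the limit independent of [x1], its second difference would be plim(0, y) - plim(0, 0) -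
    plim(0, y) = 0, against the non-zero mixed coefficient. *)
Lemma plim_depends_fst_mixed D r s C q c k0 :
  geometric D r s C q -> c <> 0 ->
  (forall k, (k0 <= k)%nat -> psum (coef 1 1) (pconcat D k) = c) ->
  depends_on_fst (plim D).
Proof.
  intros G Hc Hk [eps L].
  assert (Hr := ge_r _ _ _ _ _ G); assert (Hs := ge_s _ _ _ _ _ G).
  assert (E := plim_expansion_mixed D r s C q c k0 G Hk).
  assert (cr : c * (r * s) <> 0).
  { apply Rmult_integral_contrapositive; split; [easy |]; apply Rgt_not_eq; nra. }
  destruct (nonzero_of_expansion
    (fun t => plim D (r * t) (s * t) - plim D (r * t) 0 - plim D 0 (s * t))
    (c * (r * s)) _ 2 cr E (Rmin (eps / r) (eps / s))) as [t [Ht [_ Hv]]].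
  - apply Rmin_pos; apply Rdiv_lt_0_compat; auto; apply cond_pos.
  - assert (M1 := Rmin_l (eps / r) (eps / s)); assert (M2 := Rmin_r (eps / r) (eps / s)).
    assert (A : Rabs (r * t - 0) < eps) by (apply small_scaled; lra).
    assert (B : Rabs (s * t - 0) < eps) by (apply small_scaled; lra).
    assert (Z : Rabs (0 - 0) < eps) by (rewrite Rminus_0_r, Rabs_R0; apply cond_pos).
    apply Hv; rewrite (L _ _ A B), (L _ _ A Z), (plim_00 _ _ _ _ _ G); ring.
Qed.

(** * Functions vanishing at 0 *)

(** A right-hand limit that leaves out the value at 0, where [Rpower 0 a] would be 1. *)
Definition lim0 (f : R -> R) : Prop :=
  forall eps, 0 < eps -> exists eta, 0 < eta /\ forall x, 0 < x < eta -> Rabs (f x) < eps.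

Lemma Rpower_pos x a : 0 < Rpower x a.
Proof. apply exp_pos. Qed.

Lemma lim0_Rpower a : 0 < a -> lim0 (fun x => Rpower x a).
Proof.
  intros Ha eps He; exists (Rpower eps (/ a)); split; [apply Rpower_pos |].
  intros x [Hx1 Hx2]; rewrite Rabs_right by (apply Rle_ge, Rlt_le, Rpower_pos).
  replace eps with (Rpower (Rpower eps (/ a)) a).
  - apply Rlt_Rpower_l; auto.
  - rewrite Rpower_mult, Rinv_l, Rpower_1; lra.
Qed.

Lemma lim0_le f g C eta0 :
  0 < eta0 -> lim0 g -> (forall x, 0 < x < eta0 -> Rabs (f x) <= C * Rabs (g x)) -> lim0 f.
Proof.
  intros He0 Hg Hf eps He.
  assert (HC := Rabs_pos C).
  destruct (Hg (eps / (Rabs C + 1))) as [eta [E1 E2]]; [apply Rdiv_lt_0_compat; lra |].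
  exists (Rmin eta0 eta); split; [now apply Rmin_pos |]; intros x [X1 X2].
  assert (M1 := Rmin_l eta0 eta); assert (M2 := Rmin_r eta0 eta).
  eapply Rle_lt_trans; [apply Hf; lra |].
  specialize (E2 x ltac:(lra)).
  apply Rle_lt_trans with ((Rabs C + 1) * Rabs (g x)).
  - apply Rmult_le_compat_r; [apply Rabs_pos |]; assert (A := Rle_abs C); lra.
  - apply Rmult_lt_compat_l with (r := Rabs C + 1) in E2; [| lra].
    now replace ((Rabs C + 1) * (eps / (Rabs C + 1))) with eps in E2 by (field; lra).
Qed.

Lemma lim0_plus f g : lim0 f -> lim0 g -> lim0 (fun x => f x + g x).
Proof.
  intros Hf Hg eps He.
  destruct (Hf (eps / 2)) as [e1 [A1 B1]]; [lra |].
  destruct (Hg (eps / 2)) as [e2 [A2 B2]]; [lra |].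
  exists (Rmin e1 e2); split; [now apply Rmin_pos |]; intros x [X1 X2].
  assert (M1 := Rmin_l e1 e2); assert (M2 := Rmin_r e1 e2).
  specialize (B1 x ltac:(lra)); specialize (B2 x ltac:(lra)).
  eapply Rle_lt_trans; [apply Rabs_triang | lra].
Qed.

Lemma lim0_scal k f : lim0 f -> lim0 (fun x => k * f x).
Proof.
  intros Hf; apply lim0_le with f (Rabs k) 1; [lra | easy |].
  intros; rewrite Rabs_mult; lra.
Qed.

Lemma lim0_opp f : lim0 f -> lim0 (fun x => - f x).
Proof.
  intros Hf; apply lim0_le with f 1 1; [lra | easy |]; intros; rewrite Rabs_Ropp; lra.
Qed.

Lemma lim0_id : lim0 (fun x => x).
Proof. intros eps He; exists eps; split; [easy |]; intros; rewrite Rabs_right; lra. Qed.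

Lemma is_derive_Rpower x a : 0 < x -> is_derive (fun x => Rpower x a) x (a * (Rpower x a / x)).
Proof.
  intros Hx; apply is_derive_Reals.
  replace (Rpower x a / x) with (Rpower x (a - 1)); [now apply derivable_pt_lim_power |].
  unfold Rminus, Rdiv; rewrite Rpower_plus, Rpower_Ropp, Rpower_1; auto.
Qed.

Lemma incr_of_derivative f df a b :
  a <= b -> (forall x, a <= x <= b -> is_derive f x (df x)) ->
  (forall x, a <= x <= b -> 0 <= df x) -> f a <= f b.
Proof.
  intros Hab Hd Hp.
  destruct (MVT_gen f a b df) as [c [Hc E]].
  - intros x Hx; rewrite Rmin_left, Rmax_right in Hx by easy; apply Hd; lra.
  - intros x Hx; rewrite Rmin_left, Rmax_right in Hx by easy.
    apply continuity_pt_filterlim, (ex_derive_continuous f); exists (df x); now apply Hd.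
  - rewrite Rmin_left, Rmax_right in Hc by easy.
    assert (0 <= df c * (b - a)) by (apply Rmult_le_pos; [now apply Hp | lra]); lra.
Qed.

(** Replaces integration from 0: if [f x < 0], monotonicity keeps [f] below that value all the way
    to 0, against its limit. *)
Lemma nonneg_of_derivative f df c :
  lim0 f -> (forall x, 0 < x <= c -> is_derive f x (df x)) ->
  (forall x, 0 < x <= c -> 0 <= df x) -> forall x, 0 < x <= c -> 0 <= f x.
Proof.
  intros L Hd Hp x Hx; apply Rnot_lt_le; intros N.
  destruct (L (- f x)) as [eta [E1 E2]]; [lra |].
  set (y := Rmin x eta / 2).
  assert (M1 := Rmin_l x eta); assert (M2 := Rmin_r x eta).
  assert (M3 : 0 < Rmin x eta) by (apply Rmin_pos; lra).
  assert (Hy : 0 < y < eta) by (unfold y; lra).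
  assert (Hyx : y <= x) by (unfold y; lra).
  specialize (E2 y Hy); apply Rabs_def2 in E2.
  assert (f y <= f x); [| lra].
  apply incr_of_derivative with df; auto; intros z Hz; [apply Hd | apply Hp]; lra.
Qed.

Lemma Rpower_le_1 x a : 0 < x <= 1 -> 0 <= a -> Rpower x a <= 1.
Proof.
  intros Hx Ha; replace 1 with (Rpower 1 a) by (unfold Rpower; rewrite ln_1, Rmult_0_r, exp_0; easy).
  now apply Rle_Rpower_l.
Qed.

(** With the integrating factor x^k, the derivative of x^k f is x^(k-1) g, and the bound on [g]
    integrates to M x^(gam+k) / (gam+k). The condition [lim0 f] excludes the homogeneous solution
    x^(-k). *)
Lemma theta_upper f df g k gam M c :
  0 < c <= 1 -> 0 <= k -> 0 < gam ->
  (forall x, 0 < x <= c -> is_derive f x (df x)) ->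
  (forall x, 0 < x <= c -> x * df x + k * f x = g x) ->
  (forall x, 0 < x <= c -> g x <= M * Rpower x gam) ->
  lim0 f -> forall x, 0 < x <= c -> f x <= M / (gam + k) * Rpower x gam.
Proof.
  intros Hc Hk Hg Hd He Hb L x Hx.
  set (h := fun x => M / (gam + k) * Rpower x (gam + k) - f x * Rpower x k).
  assert (hx : 0 <= h x).
  { apply (nonneg_of_derivative h
      (fun x => (Rpower x k / x) * (M * Rpower x gam - g x)) c); auto.
    - apply lim0_plus; [apply lim0_scal, lim0_Rpower; lra |].
      apply lim0_le with f 1 1; [lra | easy |]; intros y Hy.
      rewrite Rabs_Ropp, Rabs_mult, Rmult_comm.
      apply Rmult_le_compat_r; [apply Rabs_pos |].
      rewrite Rabs_right by (apply Rle_ge, Rlt_le, Rpower_pos).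
      apply Rpower_le_1; lra.
    - intros y Hy; rewrite <- (He y Hy); unfold h.
      evar_last.
      + apply (is_derive_minus (fun x => M / (gam + k) * Rpower x (gam + k))
          (fun x => f x * Rpower x k)).
        * apply is_derive_scal, is_derive_Rpower; lra.
        * apply (is_derive_mult f (fun x => Rpower x k));
            [now apply Hd | apply is_derive_Rpower; lra | intros; apply Rmult_comm].
      + rewrite Rpower_plus; unfold minus, plus, opp, mult, scal; simpl; unfold mult; simpl.
        field; lra.
    - intros y Hy; apply Rmult_le_pos.
      + apply Rlt_le, Rdiv_lt_0_compat; [apply Rpower_pos | lra].
      + specialize (Hb y Hy); lra. }
  unfold h in hx; rewrite Rpower_plus in hx.
  apply Rmult_le_reg_r with (Rpower x k); [apply Rpower_pos | lra].
Qed.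

Lemma theta_bound f df g k gam M c :
  0 < c <= 1 -> 0 <= k -> 0 < gam ->
  (forall x, 0 < x <= c -> is_derive f x (df x)) ->
  (forall x, 0 < x <= c -> x * df x + k * f x = g x) ->
  (forall x, 0 < x <= c -> Rabs (g x) <= M * Rpower x gam) ->
  lim0 f -> forall x, 0 < x <= c -> Rabs (f x) <= M / (gam + k) * Rpower x gam.
Proof.
  intros Hc Hk Hg Hd He Hb L x Hx; apply Rabs_le; split.
  - assert (- f x <= M / (gam + k) * Rpower x gam); [| lra].
    apply (theta_upper (fun x => - f x) (fun x => - df x) (fun x => - g x) k gam M c); auto.
    + intros y Hy; apply (is_derive_opp f y (df y)); auto.
    + intros y Hy; rewrite <- (He y Hy); ring.
    + intros y Hy; specialize (Hb y Hy); apply Rabs_le_between in Hb; lra.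
    + now apply lim0_opp.
  - apply (theta_upper f df g k gam M c); auto.
    intros y Hy; specialize (Hb y Hy); apply Rabs_le_between in Hb; lra.
Qed.

(** * Asymptotics of the profile *)

Definition bigO (a : R) (f : R -> R) : Prop :=
  exists C eta, 0 < eta <= 1 /\ forall x, 0 < x < eta -> Rabs (f x) <= C * Rpower x a.

Lemma bigO_const_nonneg a f C eta :
  0 < eta -> (forall x, 0 < x < eta -> Rabs (f x) <= C * Rpower x a) -> 0 <= C.
Proof.
  intros He Hf; specialize (Hf (eta / 2) ltac:(lra)).
  assert (A := Rabs_pos (f (eta / 2))); assert (B := Rpower_pos (eta / 2) a); nra.
Qed.

Lemma bigO_ext a f g : (forall x, 0 < x < 1 -> f x = g x) -> bigO a f -> bigO a g.
Proof.
  intros E [C [eta [He Hf]]]; exists C, eta; split; [easy |].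
  intros x Hx; rewrite <- E by lra; now apply Hf.
Qed.

Lemma bigO_plus a f g : bigO a f -> bigO a g -> bigO a (fun x => f x + g x).
Proof.
  intros [C1 [e1 [A1 B1]]] [C2 [e2 [A2 B2]]].
  exists (C1 + C2), (Rmin e1 e2).
  assert (M1 := Rmin_l e1 e2); assert (M2 := Rmin_r e1 e2).
  split; [split; [apply Rmin_pos |]; lra |]; intros x Hx.
  specialize (B1 x ltac:(lra)); specialize (B2 x ltac:(lra)).
  eapply Rle_trans; [apply Rabs_triang | lra].
Qed.

Lemma bigO_mult a b c f g :
  a + b = c -> bigO a f -> bigO b g -> bigO c (fun x => f x * g x).
Proof.
  intros <- [C1 [e1 [A1 B1]]] [C2 [e2 [A2 B2]]].
  exists (C1 * C2), (Rmin e1 e2).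
  assert (M1 := Rmin_l e1 e2); assert (M2 := Rmin_r e1 e2).
  split; [split; [apply Rmin_pos |]; lra |]; intros x Hx.
  specialize (B1 x ltac:(lra)); specialize (B2 x ltac:(lra)).
  rewrite Rabs_mult, Rpower_plus.
  replace (C1 * C2 * (Rpower x a * Rpower x b)) with ((C1 * Rpower x a) * (C2 * Rpower x b)) by ring.
  apply Rmult_le_compat; auto; apply Rabs_pos.
Qed.

Lemma bigO_weaken a b f : b <= a -> bigO a f -> bigO b f.
Proof.
  intros Hab [C [eta [He Hf]]]; exists C, eta; split; [easy |]; intros x Hx.
  eapply Rle_trans; [now apply Hf |].
  apply Rmult_le_compat_l; [now apply (bigO_const_nonneg a f C eta) |].
  replace a with (b + (a - b)) by ring; rewrite Rpower_plus.
  assert (A := Rpower_pos x b); assert (B := Rpower_le_1 x (a - b) ltac:(lra) ltac:(lra)).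
  nra.
Qed.

Lemma bigO_const k : bigO 0 (fun _ => k).
Proof.
  exists (Rabs k), 1; split; [lra |]; intros; rewrite Rpower_O; lra.
Qed.

Lemma bigO_id : bigO 1 (fun x => x).
Proof.
  exists 1, 1; split; [lra |]; intros; rewrite Rpower_1, Rabs_right; lra.
Qed.

Lemma bigO_scal a k f : bigO a f -> bigO a (fun x => k * f x).
Proof. apply bigO_mult with (a := 0); [ring | apply bigO_const]. Qed.

Lemma bigO_inv_1mx : bigO 0 (fun x => / (1 - x)).
Proof.
  exists 2, (/ 2); split; [lra |]; intros x Hx.
  rewrite Rpower_O, Rmult_1_r by lra.
  rewrite Rabs_right by (apply Rle_ge, Rlt_le, Rinv_0_lt_compat; lra).
  replace 2 with (/ (/ 2)) by field; apply Rinv_le_contravar; lra.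
Qed.

Lemma bigO_lim0 a f : 0 < a -> bigO a f -> lim0 f.
Proof.
  intros Ha [C [eta [He Hf]]].
  apply lim0_le with (fun x => Rpower x a) C eta; [lra | now apply lim0_Rpower |].
  intros x Hx; rewrite (Rabs_right (Rpower x a)); [now apply Hf |].
  apply Rle_ge, Rlt_le, Rpower_pos.
Qed.

Lemma bigO_theta f df g k a :
  0 <= k -> 0 < a ->
  (forall x, 0 < x < 1 -> is_derive f x (df x)) ->
  (forall x, 0 < x < 1 -> x * df x + k * f x = g x) ->
  bigO a g -> lim0 f -> bigO a f.
Proof.
  intros Hk Ha Hd He [C [eta [Heta Hg]]] L.
  exists (C / (a + k)), (eta / 2); split; [lra |]; intros x Hx.
  apply (theta_bound f df g k a C (eta / 2)); auto; try lra; intros y Hy;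
    [apply Hd | apply He | apply Hg]; lra.
Qed.

(* [P] stands for [H'' - m / (1 - x) * H'], the Laplacian of [H] in the radial variable [1 - x]. *)
Record profile (m n : R) (H H1 P : R -> R) : Prop := {
  pr_H : forall x, 0 < x < 1 -> is_derive H x (H1 x);
  pr_H1 : forall x, 0 < x < 1 -> is_derive H1 x (P x + m / (1 - x) * H1 x);
  pr_P : forall x, 0 < x < 1 -> is_derive P x (- ((1 - x) * Rpower (H x) (1 - n)));
  pr_pos : forall x, 0 < x < 1 -> 0 < H x;
  pr_lim : lim0 H;
  pr_lim1 : lim0 H1 }.

(** * Size of the profile and limit of [P] at 0 *)

Lemma profile_P_decr m n H H1 P x y :
  profile m n H H1 P -> 0 < x <= y -> y < 1 -> P y <= P x.
Proof.
  intros PR Hx Hy.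
  assert (- P x <= - P y); [| lra].
  apply (incr_of_derivative (fun x => - P x) (fun x => - - ((1 - x) * Rpower (H x) (1 - n))));
    [lra | |].
  - intros z Hz; apply (is_derive_opp P z); apply (pr_P _ _ _ _ _ PR); lra.
  - intros z Hz; rewrite Ropp_involutive; apply Rmult_le_pos; [lra | apply Rlt_le, Rpower_pos].
Qed.

(** Divergence form of the radial Laplacian. It lets signs and bounds of [P] be integrated to ones
    of [H1] although [P] contains a multiple of [H1]. *)
Lemma profile_flux p n H H1 P x :
  profile (INR p) n H H1 P -> 0 < x < 1 ->
  is_derive (fun x => (1 - x) ^ p * H1 x) x ((1 - x) ^ p * P x).
Proof.
  intros PR Hx; evar_last.
  - apply (is_derive_mult (fun x => (1 - x) ^ p) H1 x (- (INR p * (1 - x) ^ pred p)));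
      [| now apply (pr_H1 _ _ _ _ _ PR) | intros; apply Rmult_comm].
    evar_last.
    + apply (is_derive_pow (fun x => 1 - x) p x (-1)).
      auto_derive; [easy | ring].
    + ring.
  - unfold plus, mult; simpl; destruct p as [|p].
    + simpl; field; lra.
    + simpl pred; simpl pow; field; lra.
Qed.

Lemma pow_1mx_le_1 p x : 0 < x < 1 -> 0 < (1 - x) ^ p <= 1.
Proof.
  intros Hx; split; [apply pow_lt; lra |].
  apply Rle_trans with (1 ^ p); [apply pow_incr; lra | rewrite pow1; lra].
Qed.

Lemma lim0_flux p H1 : lim0 H1 -> lim0 (fun x => (1 - x) ^ p * H1 x).
Proof.
  intros L; apply lim0_le with H1 1 1; [lra | easy |]; intros x Hx.
  rewrite Rabs_mult; apply Rmult_le_compat_r; [apply Rabs_pos |].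
  assert (A := pow_1mx_le_1 p x Hx); rewrite Rabs_right; lra.
Qed.

(** Otherwise the flux, which starts from 0, would be nonpositive on [(0, / 2]]; then so would [H1],
    and finally [H]. *)
Lemma profile_P_pos p n H H1 P :
  profile (INR p) n H H1 P -> exists x0, 0 < x0 <= / 2 /\ 0 < P x0.
Proof.
  intros PR; apply NNPP; intros N.
  assert (NP : forall x, 0 < x <= / 2 -> P x <= 0).
  { intros x Hx; apply Rnot_lt_le; intros Q; apply N; exists x; now split. }
  assert (F : forall x, 0 < x <= / 2 -> 0 <= - ((1 - x) ^ p * H1 x)).
  { apply nonneg_of_derivative with (fun x => - ((1 - x) ^ p * P x)).
    - now apply lim0_opp, lim0_flux, (pr_lim1 _ _ _ _ _ PR).
    - intros x Hx; apply (is_derive_opp (fun x => (1 - x) ^ p * H1 x)).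
      apply (profile_flux p n H H1 P x PR); lra.
    - intros x Hx; assert (A := pow_1mx_le_1 p x ltac:(lra)); specialize (NP x Hx); nra. }
  assert (G : forall x, 0 < x <= / 2 -> 0 <= - H x).
  { apply nonneg_of_derivative with (fun x => - H1 x).
    - now apply lim0_opp, (pr_lim _ _ _ _ _ PR).
    - intros x Hx; apply (is_derive_opp H); apply (pr_H _ _ _ _ _ PR); lra.
    - intros x Hx; assert (A := pow_1mx_le_1 p x ltac:(lra)); specialize (F x Hx).
      apply Rnot_lt_le; intros Q; nra. }
  specialize (G (/ 2) ltac:(lra)).
  assert (A := pr_pos _ _ _ _ _ PR (/ 2) ltac:(lra)); lra.
Qed.

Lemma profile_lower p n H H1 P :
  profile (INR p) n H H1 P ->
  exists x0 c, 0 < x0 <= / 2 /\ 0 < c /\ forall x, 0 < x <= x0 -> c * x ^ 2 <= H x.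
Proof.
  intros PR; destruct (profile_P_pos p n H H1 P PR) as [x0 [Hx0 HP]].
  (* On [(0, x0]] one has [(/ 2) ^ p <= (1 - x) ^ p] and, as [P] decreases, [P x0 <= P x]; so the
     derivative of the flux is at least [c1]. *)
  set (c1 := (/ 2) ^ p * P x0).
  assert (c1_pos : 0 < c1) by (apply Rmult_lt_0_compat; [apply pow_lt; lra | easy]).
  assert (F : forall x, 0 < x <= x0 -> 0 <= (1 - x) ^ p * H1 x - c1 * x).
  { apply nonneg_of_derivative with (fun x => (1 - x) ^ p * P x - c1).
    - apply lim0_plus; [now apply lim0_flux, (pr_lim1 _ _ _ _ _ PR) |].
      apply lim0_opp, lim0_scal, lim0_id.
    - intros x Hx; apply (is_derive_minus (fun x => (1 - x) ^ p * H1 x) (fun x => c1 * x)).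
      + apply (profile_flux p n H H1 P x PR); lra.
      + auto_derive; [easy | ring].
    - intros x Hx; assert (A := profile_P_decr _ _ _ _ _ x x0 PR ltac:(lra) ltac:(lra)).
      assert (B : (/ 2) ^ p <= (1 - x) ^ p) by (apply pow_incr; lra).
      assert (0 < (/ 2) ^ p) by (apply pow_lt; lra).
      assert ((/ 2) ^ p * P x0 <= (1 - x) ^ p * P x) by (apply Rmult_le_compat; lra).
      unfold c1; lra. }
  exists x0, (c1 / 2); repeat split; try lra; intros x Hx.
  assert (0 <= H x - c1 / 2 * x ^ 2); [| lra].
  apply (nonneg_of_derivative (fun x => H x - c1 / 2 * x ^ 2) (fun x => H1 x - c1 * x) x0); auto.
  - apply lim0_plus; [apply (pr_lim _ _ _ _ _ PR) |].
    apply lim0_opp, lim0_scal, lim0_le with (fun x => x) 1 1; [lra | apply lim0_id |].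
    intros y Hy; simpl; rewrite !Rabs_right; nra.
  - intros y Hy; apply (is_derive_minus H (fun x => c1 / 2 * x ^ 2)).
    + apply (pr_H _ _ _ _ _ PR); lra.
    + auto_derive; [easy | field].
  - intros y Hy; specialize (F y Hy); assert (A := pow_1mx_le_1 p y ltac:(lra)).
    assert (0 < c1 * y) by (apply Rmult_lt_0_compat; lra).
    assert (0 < H1 y) by (apply Rnot_le_lt; intros Q; nra).
    nra.
Qed.

Lemma Rpower_anti x y a : 0 < x <= y -> a <= 0 -> Rpower y a <= Rpower x a.
Proof.
  intros Hx Ha; replace a with (- - a) by ring; rewrite !(Rpower_Ropp _ (- a)).
  apply Rinv_le_contravar; [apply Rpower_pos | apply Rle_Rpower_l; lra].
Qed.

Lemma Rpower_square x a : 0 < x -> Rpower (x ^ 2) a = Rpower x (2 * a).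
Proof. intros Hx; rewrite <- Rpower_pow, Rpower_mult by easy; reflexivity. Qed.

(** Used with a = 1 - n, which takes either sign; the maximum covers the increasing and the
    decreasing power at once. *)
Lemma Rpower_between c C x h a :
  0 < c -> 0 < C -> 0 < x -> c * x ^ 2 <= h <= C * x ^ 2 ->
  Rpower h a <= Rmax (Rpower c a) (Rpower C a) * Rpower x (2 * a).
Proof.
  intros Hc HC Hx Hh.
  assert (X : 0 < x ^ 2) by (apply pow_lt; easy).
  assert (cX : 0 < c * x ^ 2) by (now apply Rmult_lt_0_compat).
  assert (CX : 0 < C * x ^ 2) by (now apply Rmult_lt_0_compat).
  assert (p := Rpower_pos x (2 * a)).
  destruct (Rle_dec 0 a).
  - apply Rle_trans with (Rpower (C * x ^ 2) a); [apply Rle_Rpower_l; lra |].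
    rewrite <- Rpower_mult_distr, Rpower_square by easy.
    apply Rmult_le_compat_r; [lra | apply Rmax_r].
  - apply Rle_trans with (Rpower (c * x ^ 2) a); [apply Rpower_anti; lra |].
    rewrite <- Rpower_mult_distr, Rpower_square by easy.
    apply Rmult_le_compat_r; [lra | apply Rmax_l].
Qed.

Lemma Rpower_2 x : 0 < x -> Rpower x 2 = x ^ 2.
Proof. intros Hx; now rewrite <- Rpower_pow. Qed.

(** The hypothesis says P' >= - C x^(b-1), integrable because b > 0. Together with the decrease of
    [P] this squeezes [P] near 0 without any integral. *)
Lemma profile_P_incr m n H H1 P C b x1 :
  profile m n H H1 P -> 0 < b -> x1 < 1 ->
  (forall x, 0 < x <= x1 -> Rpower (H x) (1 - n) <= C * Rpower x (b - 1)) ->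
  forall x y, 0 < x <= y -> y <= x1 ->
    P x + C / b * Rpower x b <= P y + C / b * Rpower y b.
Proof.
  intros PR Hb Hx1 B x y Hx Hy.
  apply (incr_of_derivative (fun x => P x + C / b * Rpower x b)
    (fun x => - ((1 - x) * Rpower (H x) (1 - n)) + C / b * (b * (Rpower x b / x))));
    [lra | |]; intros z Hz.
  - apply (is_derive_plus P (fun x => C / b * Rpower x b)).
    + apply (pr_P _ _ _ _ _ PR); lra.
    + apply is_derive_scal, is_derive_Rpower; lra.
  - specialize (B z ltac:(lra)).
    replace (C / b * (b * (Rpower z b / z))) with (C * Rpower z (b - 1)).
    + assert (Q := Rpower_pos (H z) (1 - n)); nra.
    + unfold Rminus; rewrite Rpower_plus, Rpower_Ropp, Rpower_1 by lra; field; lra.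
Qed.

Lemma profile_P_bounded p n H H1 P :
  n < 3 / 2 -> profile (INR p) n H H1 P ->
  exists x1 M, 0 < x1 <= / 2 /\ forall x, 0 < x <= x1 -> P x <= M.
Proof.
  intros Hn PR; destruct (profile_lower p n H H1 P PR) as [x0 [c [Hx0 [Hc HL]]]].
  (* At this stage only the lower bound on [H] is quantitative. It suffices for n >= 1, where the
     power is decreasing in [H] and b = 3 - 2 n is positive because n < 3/2; for n < 1 the crude
     bound [H x <= 1] near 0 gives b = 1. *)
  assert (E : exists x1 C b, 0 < x1 <= / 2 /\ 0 < b /\
    forall x, 0 < x <= x1 -> Rpower (H x) (1 - n) <= C * Rpower x (b - 1)).
  { destruct (Rle_dec 1 n) as [N|N].
    - exists x0, (Rpower c (1 - n)), (3 - 2 * n); repeat split; try lra; intros x Hx.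
      assert (X : 0 < x ^ 2) by (apply pow_lt; lra).
      assert (cX : 0 < c * x ^ 2) by (now apply Rmult_lt_0_compat).
      replace (3 - 2 * n - 1) with (2 * (1 - n)) by ring.
      rewrite <- Rpower_square, Rpower_mult_distr by lra.
      apply Rpower_anti; [split; [easy | now apply HL] | lra].
    - destruct (pr_lim _ _ _ _ _ PR 1 ltac:(lra)) as [eta [E1 E2]].
      exists (Rmin (/ 2) (eta / 2)), 1, 1.
      assert (M1 := Rmin_l (/ 2) (eta / 2)); assert (M2 := Rmin_r (/ 2) (eta / 2)).
      repeat split; try lra; [apply Rmin_pos; lra |]; intros x Hx.
      rewrite Rminus_diag, Rpower_O, Rmult_1_l by lra.
      apply Rpower_le_1; [| lra]; split; [apply (pr_pos _ _ _ _ _ PR); lra |].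
      specialize (E2 x ltac:(lra)); assert (A := Rle_abs (H x)); lra. }
  destruct E as [x1 [C [b [Hx1 [Hb B]]]]].
  exists x1, (P x1 + C / b * Rpower x1 b); split; [easy |]; intros x Hx.
  assert (A := profile_P_incr _ _ _ _ _ C b x1 PR Hb ltac:(lra) B x x1 Hx ltac:(lra)).
  assert (0 <= C / b * Rpower x b); [| lra].
  apply Rmult_le_pos; [| apply Rlt_le, Rpower_pos].
  apply Rmult_le_pos; [| apply Rlt_le, Rinv_0_lt_compat; lra].
  specialize (B x1 ltac:(lra)); assert (Q1 := Rpower_pos (H x1) (1 - n)).
  assert (Q2 := Rpower_pos x1 (b - 1)); nra.
Qed.

Lemma bigO_P p n H H1 P : n < 3 / 2 -> profile (INR p) n H H1 P -> bigO 0 P.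
Proof.
  intros Hn PR; destruct (profile_P_bounded p n H H1 P Hn PR) as [x1 [M [Hx1 B]]].
  exists (Rmax (Rabs (P x1)) (Rabs M)), x1; split; [lra |]; intros x Hx.
  rewrite Rpower_O, Rmult_1_r by lra.
  assert (A := profile_P_decr _ _ _ _ _ x x1 PR ltac:(lra) ltac:(lra)).
  specialize (B x ltac:(lra)).
  assert (Q1 := Rmax_l (Rabs (P x1)) (Rabs M)); assert (Q2 := Rmax_r (Rabs (P x1)) (Rabs M)).
  assert (Q3 := Rle_abs M); assert (Q4 := Rle_abs (- P x1)); rewrite Rabs_Ropp in Q4.
  apply Rabs_le; lra.
Qed.

Lemma bigO_pow_1mx p : bigO 0 (fun x => (1 - x) ^ p).
Proof.
  exists 1, 1; split; [lra |]; intros x Hx; rewrite Rpower_O by lra.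
  assert (A := pow_1mx_le_1 p x Hx); rewrite Rabs_right; lra.
Qed.

Lemma bigO_inv_pow_1mx p : bigO 0 (fun x => / (1 - x) ^ p).
Proof.
  induction p as [|p IH].
  - apply bigO_ext with (fun _ => 1); [intros; simpl; field | apply bigO_const].
  - apply bigO_ext with (fun x => / (1 - x) * / (1 - x) ^ p).
    + intros x Hx; simpl; rewrite Rinv_mult; ring.
    + apply bigO_mult with 0 0; [ring | apply bigO_inv_1mx | exact IH].
Qed.

Lemma bigO_H1 p n H H1 P : n < 3 / 2 -> profile (INR p) n H H1 P -> bigO 1 H1.
Proof.
  intros Hn PR.
  apply bigO_ext with (fun x => ((1 - x) ^ p * H1 x) * / (1 - x) ^ p).
  { intros x Hx; assert (A := pow_1mx_le_1 p x Hx); field; lra. }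
  apply bigO_mult with 1 0; [ring | | apply bigO_inv_pow_1mx].
  apply bigO_theta with (fun x => (1 - x) ^ p * P x) (fun x => x * ((1 - x) ^ p * P x)) 0;
    try lra.
  - intros x Hx; now apply profile_flux with n H.
  - intros x Hx; ring.
  - apply bigO_mult with 1 0; [ring | apply bigO_id |].
    apply bigO_mult with 0 0; [ring | apply bigO_pow_1mx | now apply bigO_P with p n H H1].
  - now apply lim0_flux, (pr_lim1 _ _ _ _ _ PR).
Qed.

Lemma bigO_H p n H H1 P : n < 3 / 2 -> profile (INR p) n H H1 P -> bigO 2 H.
Proof.
  intros Hn PR.
  apply bigO_theta with H1 (fun x => x * H1 x) 0; try lra.
  - apply (pr_H _ _ _ _ _ PR).
  - intros x Hx; ring.
  - apply bigO_mult with 1 1; [ring | apply bigO_id | now apply bigO_H1 with p n H P].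
  - apply (pr_lim _ _ _ _ _ PR).
Qed.

Lemma bigO_inv_H p n H H1 P : profile (INR p) n H H1 P -> bigO (-2) (fun x => / H x).
Proof.
  intros PR; destruct (profile_lower p n H H1 P PR) as [x0 [c [Hx0 [Hc HL]]]].
  exists (/ c), x0; split; [lra |]; intros x Hx.
  assert (X : 0 < x ^ 2) by (apply pow_lt; lra).
  replace (-2) with (Ropp 2) by ring; rewrite (Rpower_Ropp x 2), Rpower_2, <- Rinv_mult by lra.
  rewrite Rabs_right.
  - apply Rinv_le_contravar; [now apply Rmult_lt_0_compat | apply HL; lra].
  - apply Rle_ge, Rlt_le, Rinv_0_lt_compat, (pr_pos _ _ _ _ _ PR); lra.
Qed.

Lemma profile_curvature p n H H1 P :
  n < 3 / 2 -> profile (INR p) n H H1 P ->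
  exists L, 0 < L /\ bigO (3 - 2 * n) (fun x => P x - L).
Proof.
  intros Hn PR.
  destruct (profile_P_pos p n H H1 P PR) as [x0 [Hx0 HP0]].
  destruct (profile_P_bounded p n H H1 P Hn PR) as [x1 [M [Hx1 B]]].
  destruct (profile_lower p n H H1 P PR) as [x2 [c [Hx2 [Hc HL]]]].
  destruct (bigO_H p n H H1 P Hn PR) as [C [e [He HU]]].
  assert (HC : 0 <= C) by (apply (bigO_const_nonneg 2 H C e); [lra | easy]).
  set (y := Rmin (Rmin x0 x1) (Rmin x2 (e / 2))).
  assert (M1 := Rmin_l (Rmin x0 x1) (Rmin x2 (e / 2))).
  assert (M2 := Rmin_r (Rmin x0 x1) (Rmin x2 (e / 2))).
  assert (M3 := Rmin_l x0 x1); assert (M4 := Rmin_r x0 x1).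
  assert (M5 := Rmin_l x2 (e / 2)); assert (M6 := Rmin_r x2 (e / 2)).
  fold y in M1, M2.
  assert (Hy : 0 < y) by (unfold y; repeat apply Rmin_pos; lra).
  (* Now that [H] lies between multiples of x^2, the exact exponent 2 (1 - n) holds for both signs
     of 1 - n. [C + 1] is positive, whereas for [C] only [0 <= C] is at hand. *)
  set (C3 := Rmax (Rpower c (1 - n)) (Rpower (C + 1) (1 - n))).
  assert (BH : forall x, 0 < x <= y ->
    Rpower (H x) (1 - n) <= C3 * Rpower x (3 - 2 * n - 1)).
  { intros x Hx; replace (3 - 2 * n - 1) with (2 * (1 - n)) by ring.
    apply Rpower_between; try lra; split; [apply HL; lra |].
    specialize (HU x ltac:(lra)); rewrite Rpower_2 in HU by lra.
    assert (A := Rle_abs (H x)); assert (X : 0 < x ^ 2) by (apply pow_lt; lra); nra. }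
  (* As [P] decreases, its supremum on [(0, y]] is its limit at 0. *)
  set (E := fun z => exists x, 0 < x <= y /\ z = P x).
  destruct (completeness E) as [L [L1 L2]].
  - exists M; intros z [x [Hx ->]]; apply B; lra.
  - exists (P y), y; split; [lra | easy].
  - assert (UP : forall x, 0 < x <= y -> P x <= L) by (intros x Hx; apply L1; now exists x).
    exists L; split.
    + apply Rlt_le_trans with (P y); [| apply UP; lra].
      apply Rlt_le_trans with (1 := HP0), (profile_P_decr _ _ _ _ _ y x0 PR); lra.
    + exists (C3 / (3 - 2 * n)), y; split; [lra |]; intros x Hx.
      (* Every [P x'] has to lie below the right-hand side: to the left of [x] by the
         near-monotonicity just proved for [P], to the right of [x] by its decrease. *)
      assert (LO : L <= P x + C3 / (3 - 2 * n) * Rpower x (3 - 2 * n)).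
      { apply L2; intros z [x' [Hx' ->]].
        assert (C3p : 0 <= C3).
        { eapply Rle_trans; [apply Rlt_le, (Rpower_pos c (1 - n)) | apply Rmax_l]. }
        assert (D : 0 <= C3 / (3 - 2 * n))
          by (apply Rmult_le_pos; [easy | apply Rlt_le, Rinv_0_lt_compat; lra]).
        destruct (Rle_dec x' x) as [Q|Q].
        - assert (I := profile_P_incr _ _ _ _ _ C3 (3 - 2 * n) y PR ltac:(lra) ltac:(lra)
            BH x' x ltac:(lra) ltac:(lra)).
          assert (0 <= C3 / (3 - 2 * n) * Rpower x' (3 - 2 * n));
            [apply Rmult_le_pos; [easy | apply Rlt_le, Rpower_pos] | lra].
        - assert (I := profile_P_decr _ _ _ _ _ x x' PR ltac:(lra) ltac:(lra)).
          assert (0 <= C3 / (3 - 2 * n) * Rpower x (3 - 2 * n));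
            [apply Rmult_le_pos; [easy | apply Rlt_le, Rpower_pos] | lra]. }
      specialize (UP x ltac:(lra)); rewrite Rabs_left1; lra.
Qed.

(** Two errors compete: P - 2 kappa is of order x^beta, and the term m / (1 - x) H' in H'' is of
    order x. Hence the common exponent [gam], gaining one power of [x] per integration. *)
Lemma profile_expansion p n H H1 P gam :
  n < 3 / 2 -> profile (INR p) n H H1 P -> 0 < gam <= 1 -> gam <= 3 - 2 * n ->
  exists kappa, 0 < kappa /\
    bigO gam (fun x => P x - 2 * kappa) /\
    bigO (1 + gam) (fun x => H1 x - 2 * kappa * x) /\
    bigO (2 + gam) (fun x => H x - kappa * x ^ 2).
Proof.
  intros Hn PR Hg Hgb.
  destruct (profile_curvature p n H H1 P Hn PR) as [L [HL BL]].
  exists (L / 2); split; [lra |].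
  replace (2 * (L / 2)) with L by field.
  assert (B0 : bigO gam (fun x => P x - L)) by (now apply bigO_weaken with (3 - 2 * n)).
  assert (B1 : bigO (1 + gam) (fun x => H1 x - L * x)).
  { apply bigO_theta with (fun x => P x + INR p / (1 - x) * H1 x - L)
      (fun x => x * ((P x - L) + INR p * (/ (1 - x) * H1 x))) 0; try lra.
    - intros x Hx; apply (is_derive_minus H1 (fun x => L * x)).
      + now apply (pr_H1 _ _ _ _ _ PR).
      + auto_derive; [easy | ring].
    - intros x Hx; unfold Rdiv; ring.
    - apply bigO_mult with 1 gam; [ring | apply bigO_id |].
      apply bigO_plus; [exact B0 |].
      apply bigO_weaken with 1; [lra |]; apply bigO_scal.
      apply bigO_mult with 0 1; [ring | apply bigO_inv_1mx | now apply bigO_H1 with p n H P].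
    - apply lim0_plus; [apply (pr_lim1 _ _ _ _ _ PR) | apply lim0_opp, lim0_scal, lim0_id]. }
  repeat split; try assumption.
  apply bigO_theta with (fun x => H1 x - L * x) (fun x => x * (H1 x - L * x)) 0; try lra.
  - intros x Hx; apply (is_derive_minus H (fun x => L / 2 * x ^ 2)).
    + now apply (pr_H _ _ _ _ _ PR).
    + auto_derive; [easy | field].
  - intros; ring.
  - apply bigO_mult with 1 (1 + gam); [ring | apply bigO_id | exact B1].
  - apply lim0_plus; [apply (pr_lim _ _ _ _ _ PR) |].
    apply lim0_opp, bigO_lim0 with 2; [lra |]; apply bigO_scal.
    apply bigO_ext with (fun x => x * x); [intros; ring |].
    apply bigO_mult with 1 1; [ring | apply bigO_id | apply bigO_id].
Qed.

(** * Comparison of the profile with the iteration *)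

(** [lim0 f] is the condition at 0 that singles out one solution for a given right-hand side. *)
Definition theta_solves (k : R) (f g : R -> R) : Prop :=
  lim0 f /\ exists df, forall x, 0 < x < 1 ->
    is_derive f x (df x) /\ x * df x + k * f x = g x.

Record profile_system (m n beta sig gam : R) (fy fe fa fs fu : R -> R) : Prop := {
  ps_y : forall x, 0 < x < 1 -> fy x = x * (1 + fy x);
  ps_e : theta_solves 1 fe (fun x =>
    - (fa x * fe x) - sig * (Rpower x beta * (1 + fs x)) - m * (fy x * (2 + fa x)));
  ps_a : theta_solves 2 fa (fun x => fe x - fa x * fa x + m * (fy x * (2 + fa x)));
  ps_s : theta_solves 0 fs (fun x => - ((n * fa x + fy x) * (1 + fs x)));
  ps_u : theta_solves 0 fu (fun x => fa x * (1 + fu x));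
  ps_Oy : bigO gam fy; ps_Oe : bigO gam fe; ps_Oa : bigO gam fa;
  ps_Os : bigO gam fs; ps_Ou : bigO gam fu }.

Lemma monomial_Rpower x beta i j :
  0 < x -> monomial x (Rpower x beta) i j = Rpower x (weight beta i j).
Proof.
  intros Hx; unfold monomial, weight.
  rewrite <- (Rpower_pow j) by apply Rpower_pos.
  rewrite <- (Rpower_pow i) by easy.
  now rewrite Rpower_mult, Rpower_plus.
Qed.

Lemma is_derive_eval beta l x :
  0 < x ->
  is_derive (fun x => psum (monomial x (Rpower x beta)) l) x
    (psum (fun i j => weight beta i j * monomial x (Rpower x beta) i j) l / x).
Proof.
  intros Hx; induction l as [|[c [i j]] l IH]; simpl.
  - evar_last; [apply is_derive_const |]; unfold zero; simpl; field; lra.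
  - evar_last.
    + apply (is_derive_plus (fun x => c * monomial x (Rpower x beta) i j)
        (fun x => psum (monomial x (Rpower x beta)) l)); [| exact IH].
      apply is_derive_scal.
      apply is_derive_ext_loc with (fun x => Rpower x (weight beta i j));
        [| now apply is_derive_Rpower].
      apply (filter_imp (fun y => 0 < y)); [| now apply (open_gt 0)].
      intros y Hy; symmetry; now apply monomial_Rpower.
    + unfold plus; simpl; rewrite monomial_Rpower by easy; field; lra.
Qed.

Lemma theta_eval_pinv beta gam k l x :
  0 < beta -> 0 < gam <= 1 -> gam <= beta -> 0 <= k -> nonconst l ->
  psum (fun i j => (weight beta i j + k) * monomial x (Rpower x beta) i j) (pinv beta k l)
  = psum (monomial x (Rpower x beta)) l.
Proof.
  intros Hb Hg Hgb Hk Hl; rewrite psum_pinv.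
  induction Hl as [|[c [i j]] l Hc Hl IH]; simpl; [easy |]; rewrite IH.
  assert (W := weight_ge beta gam i j Hb (proj2 Hg) Hgb Hc); field; lra.
Qed.

(** For lam >= gam and x <= c one has x^lam <= c^lam (x/c)^gam. So the l^1 norm at [(c, c^beta)]
    controls polynomials in the sup norm with weight (x/c)^gam, in which the functions are
    measured. *)
Lemma eval_bound beta gam c l x :
  0 < beta -> 0 < gam <= 1 -> gam <= beta -> nonconst l -> 0 < x <= c ->
  Rabs (psum (monomial x (Rpower x beta)) l)
  <= pnorm c (Rpower c beta) l * (Rpower x gam / Rpower c gam).
Proof.
  intros Hb Hg Hgb Hl Hx; rewrite Rmult_comm.
  apply psum_bound_nonconst; [| easy]; intros i j Hij.
  rewrite !monomial_Rpower by lra.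
  rewrite Rabs_right by (apply Rle_ge, Rlt_le, Rpower_pos).
  assert (W := weight_ge beta gam i j Hb (proj2 Hg) Hgb Hij).
  set (lam := weight beta i j) in *.
  replace lam with (gam + (lam - gam)) by ring; rewrite !Rpower_plus.
  assert (A := Rpower_pos c gam); assert (B := Rpower_pos x gam).
  replace (Rpower x gam / Rpower c gam * (Rpower c gam * Rpower c (lam - gam)))
    with (Rpower x gam * Rpower c (lam - gam)) by (field; lra).
  apply Rmult_le_compat_l; [lra |]; apply Rle_Rpower_l; lra.
Qed.

Lemma lim0_eval beta gam l :
  0 < beta -> 0 < gam <= 1 -> gam <= beta -> nonconst l ->
  lim0 (fun x => psum (monomial x (Rpower x beta)) l).
Proof.
  intros Hb Hg Hgb Hl; apply bigO_lim0 with gam; [easy |].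
  exists (pnorm 1 (Rpower 1 beta) l / Rpower 1 gam), 1; split; [lra |]; intros x Hx.
  eapply Rle_trans; [apply (eval_bound beta gam 1); auto; lra |].
  right; unfold Rdiv; ring.
Qed.

(** The difference between the function and the polynomial solves the same first-order equation with
    the difference of the sources. Integrating it gains a factor 1 / (gam + k), which the choice of
    [q] absorbs. *)
Lemma component_step beta gam c k q B f g l :
  0 < beta -> 0 < gam <= 1 -> gam <= beta -> 0 <= k -> 0 < q <= gam + k -> 0 < c < 1 ->
  0 <= B -> theta_solves k f g -> nonconst l ->
  (forall x, 0 < x <= c ->
    Rabs (g x - psum (monomial x (Rpower x beta)) l)
    <= q * (B * (Rpower x gam / Rpower c gam))) ->
  forall x, 0 < x <= c ->
    Rabs (f x - psum (monomial x (Rpower x beta)) (pinv beta k l))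
    <= B * (Rpower x gam / Rpower c gam).
Proof.
  intros Hb Hg Hgb Hk Hq Hc HB [L [df Hf]] Hl Hd x Hx.
  set (ev := fun x l => psum (monomial x (Rpower x beta)) l).
  assert (Pc := Rpower_pos c gam).
  eapply Rle_trans.
  - apply (theta_bound (fun x => f x - ev x (pinv beta k l))
      (fun x => df x - psum (fun i j => weight beta i j * monomial x (Rpower x beta) i j)
                         (pinv beta k l) / x)
      (fun x => g x - ev x l) k gam (q * (B / Rpower c gam)) c); auto; try lra.
    + intros y Hy; apply (is_derive_minus f (fun x => ev x (pinv beta k l))).
      * apply Hf; lra.
      * apply is_derive_eval; lra.
    + intros y Hy; unfold ev.
      rewrite <- (proj2 (Hf y ltac:(lra))), <- (theta_eval_pinv beta gam k l y) by easy.
      rewrite (psum_ext (fun i j => (weight beta i j + k) * _)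
        (fun i j => weight beta i j * monomial y (Rpower y beta) i j
                    + k * monomial y (Rpower y beta) i j)) by (intros; ring).
      rewrite psum_plus, psum_scal; field; lra.
    + intros y Hy; eapply Rle_trans; [now apply Hd |]; right; unfold Rdiv; ring.
    + apply lim0_plus; [easy |]; apply lim0_opp.
      apply lim0_eval with gam; auto; now apply nonconst_pinv.
  - apply Rle_trans with ((q / (gam + k)) * (B * (Rpower x gam / Rpower c gam))).
    + right; field; lra.
    + rewrite <- (Rmult_1_l (B * _)) at 2; apply Rmult_le_compat_r.
      * apply Rmult_le_pos; [lra |].
        apply Rlt_le, Rdiv_lt_0_compat; [apply Rpower_pos | easy].
      * apply Rmult_le_reg_r with (gam + k); [lra |].
        replace (q / (gam + k) * (gam + k)) with q by (field; lra); lra.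
Qed.

(** The component weights are those of [state_bound]. With [state0] in place of [Y] it is a size
    bound on the functions themselves, since the empty list evaluates to 0. *)
Record close (beta gam c K del mu : R) (fy fe fa fs fu : R -> R) (Y : state) : Prop := {
  cl_y : forall x, 0 < x <= c -> Rabs (fy x - psum (monomial x (Rpower x beta)) (cy Y))
    <= del * mu * (Rpower x gam / Rpower c gam);
  cl_e : forall x, 0 < x <= c -> Rabs (fe x - psum (monomial x (Rpower x beta)) (ce Y))
    <= mu * (Rpower x gam / Rpower c gam);
  cl_a : forall x, 0 < x <= c -> Rabs (fa x - psum (monomial x (Rpower x beta)) (ca Y))
    <= mu * (Rpower x gam / Rpower c gam);
  cl_s : forall x, 0 < x <= c -> Rabs (fs x - psum (monomial x (Rpower x beta)) (cs Y))
    <= K * mu * (Rpower x gam / Rpower c gam);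
  cl_u : forall x, 0 < x <= c -> Rabs (fu x - psum (monomial x (Rpower x beta)) (cu Y))
    <= K * mu * (Rpower x gam / Rpower c gam) }.

Lemma close_eq beta gam c K del mu fy fe fa fs fu Y Z :
  state_eq Y Z -> close beta gam c K del mu fy fe fa fs fu Z ->
  close beta gam c K del mu fy fe fa fs fu Y.
Proof.
  intros [E1 E2 E3 E4 E5] [C1 C2 C3 C4 C5].
  split; intros x Hx; [rewrite E1 | rewrite E2 | rewrite E3 | rewrite E4 | rewrite E5]; auto.
Qed.

Ltac abs_bound :=
  repeat match goal with
  | |- Rabs (_ + _) <= _ + _ => eapply Rle_trans; [apply Rabs_triang | apply Rplus_le_compat]
  | |- Rabs (- _) <= _ => rewrite Rabs_Ropp
  | |- Rabs (_ * _) <= _ * _ =>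
      rewrite Rabs_mult; apply Rmult_le_compat; [apply Rabs_pos | apply Rabs_pos | |]
  | |- Rabs ?x <= Rabs ?x => apply Rle_refl
  | |- Rabs ?x <= ?x => rewrite Rabs_right; lra
  end.

(** The functions coming from [H] are a fixed point of the map that [phi] represents, so the
    contraction applies to their distance from an iterate. It is used pointwise, at scale
    [mu * w x]. *)
Lemma close_step m n beta gam sig K del Rb c mu fy fe fa fs fu Y :
  small_params m n gam sig K del Rb c (Rpower c beta) ->
  0 < beta -> gam <= beta -> c < 1 -> 0 <= mu ->
  profile_system m n beta sig gam fy fe fa fs fu ->
  close beta gam c K del Rb fy fe fa fs fu state0 ->
  state_nonconst Y -> state_bound c (Rpower c beta) K del Rb Y ->
  close beta gam c K del mu fy fe fa fs fu Y ->
  close beta gam c K del (3 / 4 * mu) fy fe fa fs fu (phi m n beta sig Y).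
Proof.
  intros SP Hb Hgb Hc1 Hmu PS C0 NY BY CY.
  assert (CC := small_params_contraction _ _ _ _ _ _ _ _ _ SP).
  assert (NP := phi_nonconst m n beta sig Y NY).
  assert (KK := cc_K _ _ _ _ _ _ _ _ _ CC).
  assert (dd := cc_del _ _ _ _ _ _ _ _ _ CC).
  assert (RR := cc_R _ _ _ _ _ _ _ _ _ CC).
  destruct SP as [Hm Hn Hg Hsig HK Hdel HR Hr Hs Hss].
  set (w := fun x => Rpower x gam / Rpower c gam).
  assert (Hw : forall x, 0 < x <= c -> 0 <= w x <= 1).
  { intros x Hx; unfold w; assert (A := Rpower_pos c gam); assert (B := Rpower_pos x gam).
    split; [apply Rlt_le, Rdiv_lt_0_compat; lra |].
    apply Rmult_le_reg_r with (Rpower c gam); [lra |].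
    replace (Rpower x gam / Rpower c gam * Rpower c gam) with (Rpower x gam) by (field; lra).
    rewrite Rmult_1_l; apply Rle_Rpower_l; lra. }
  set (ev := fun x l => psum (monomial x (Rpower x beta)) l).
  assert (ST : forall x, 0 < x <= c ->
    let dy := fy x - ev x (cy Y) in let de := fe x - ev x (ce Y) in
    let da := fa x - ev x (ca Y) in let ds := fs x - ev x (cs Y) in
    let du := fu x - ev x (cu Y) in let X2 := Rpower x beta in
    Rabs x * Rabs dy <= del * (3 / 4 * (mu * w x)) /\
    Rabs da * Rabs (fe x) + Rabs (ev x (ca Y)) * Rabs de + sig * (Rabs X2 * Rabs ds)
      + m * (Rabs dy * (2 + Rabs (fa x)) + Rabs (ev x (cy Y)) * Rabs da)
      <= 3 / 4 * (mu * w x) /\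
    / 2 * (Rabs de + (Rabs da * Rabs (fa x) + Rabs (ev x (ca Y)) * Rabs da)
      + m * (Rabs dy * (2 + Rabs (fa x)) + Rabs (ev x (cy Y)) * Rabs da))
      <= 3 / 4 * (mu * w x) /\
    / gam * ((n * Rabs da + Rabs dy) * (1 + Rabs (fs x))
      + (n * Rabs (ev x (ca Y)) + Rabs (ev x (cy Y))) * Rabs ds)
      <= K * (3 / 4 * (mu * w x)) /\
    / gam * (Rabs da * (1 + Rabs (fu x)) + Rabs (ev x (ca Y)) * Rabs du)
      <= K * (3 / 4 * (mu * w x))).
  { intros x Hx dy de da ds du X2.
    assert (W := Hw x Hx); assert (Wmu : 0 <= mu * w x) by (apply Rmult_le_pos; lra).
    assert (KR : 0 < K * Rb) by nra; assert (dR : 0 < del * Rb) by nra.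
    (* In each product difference one factor is a function and the other an iterate: [Z] bounds the
       former through [C0], [E] the latter through its norm. *)
    assert (Z : forall f l, Rabs (f x - ev x []) <= l * w x -> 0 < l -> 0 <= Rabs (f x) <= l).
    { intros f l Hl l0; split; [apply Rabs_pos |].
      unfold ev in Hl; simpl in Hl; rewrite Rminus_0_r in Hl; nra. }
    assert (E : forall l b, nonconst l -> pnorm c (Rpower c beta) l <= b -> 0 < b ->
      0 <= Rabs (ev x l) <= b).
    { intros l b Nl Bl b0; split; [apply Rabs_pos |].
      eapply Rle_trans; [apply (eval_bound beta gam c); auto |].
      assert (Q := pnorm_nonneg c (Rpower c beta) l ltac:(lra) ltac:(lra)).
      fold (w x); nra. }
    destruct NY as [N1 N2 N3 N4 N5], BY as [B1 B2 B3 B4 B5].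
    apply (contraction_step m n gam sig K del Rb c (Rpower c beta) (mu * w x)); auto;
      try lra; try (now apply E).
    - rewrite Rabs_right; lra.
    - unfold X2; rewrite Rabs_right by (apply Rle_ge, Rlt_le, Rpower_pos).
      split; [apply Rlt_le, Rpower_pos | apply Rle_Rpower_l; lra].
    - split; [apply Rabs_pos |]; rewrite <- Rmult_assoc; now apply (cl_y _ _ _ _ _ _ _ _ _ _ _ _ CY).
    - split; [apply Rabs_pos |]; now apply (cl_e _ _ _ _ _ _ _ _ _ _ _ _ CY).
    - split; [apply Rabs_pos |]; now apply (cl_a _ _ _ _ _ _ _ _ _ _ _ _ CY).
    - split; [apply Rabs_pos |]; rewrite <- Rmult_assoc; now apply (cl_s _ _ _ _ _ _ _ _ _ _ _ _ CY).
    - split; [apply Rabs_pos |]; rewrite <- Rmult_assoc; now apply (cl_u _ _ _ _ _ _ _ _ _ _ _ _ CY).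
    - apply Z; [now apply (cl_e _ _ _ _ _ _ _ _ _ _ _ _ C0) | lra].
    - apply Z; [now apply (cl_a _ _ _ _ _ _ _ _ _ _ _ _ C0) | lra].
    - apply Z; [now apply (cl_s _ _ _ _ _ _ _ _ _ _ _ _ C0) | lra].
    - apply Z; [now apply (cl_u _ _ _ _ _ _ _ _ _ _ _ _ C0) | lra]. }
  assert (S2 : forall x, Rabs (2 + fa x) <= 2 + Rabs (fa x)).
  { intros x; eapply Rle_trans; [apply Rabs_triang |]; rewrite (Rabs_right 2); lra. }
  assert (S1 : forall f : R -> R, forall x, Rabs (1 + f x) <= 1 + Rabs (f x)).
  { intros f x; eapply Rle_trans; [apply Rabs_triang |]; rewrite (Rabs_right 1); lra. }
  assert (g0 : forall A B, / gam * A <= B -> A <= gam * B).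
  { intros A B HAB; apply Rmult_le_compat_l with (r := gam) in HAB; [| lra].
    replace (gam * (/ gam * A)) with A in HAB by (field; lra); exact HAB. }
  assert (g2 : forall A B, / 2 * A <= B -> A <= 2 * B) by (intros; lra).
  split; cbn [phi cy ce ca cs cu].
  - intros x Hx; destruct (ST x Hx) as [E _]; fold (w x).
    rewrite eval_pmul, eval_pX1, psum_app, eval_pcst; fold (ev x (cy Y)).
    rewrite (ps_y _ _ _ _ _ _ _ _ _ _ PS) by lra.
    replace (_ - _) with (x * (fy x - ev x (cy Y))) by ring.
    rewrite Rabs_mult; lra.
  - apply component_step with (g := fun x =>
      - (fa x * fe x) - sig * (Rpower x beta * (1 + fs x)) - m * (fy x * (2 + fa x))) (q := 1);
      auto; try lra; [apply (ps_e _ _ _ _ _ _ _ _ _ _ PS) | destruct NY; nonconst_tac |].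
    intros x Hx; destruct (ST x Hx) as [_ [E _]]; fold (w x).
    rewrite Rmult_1_l, Rmult_assoc; eapply Rle_trans; [| exact E].
    rewrite !psum_app, !eval_pmul, !psum_app, !eval_pcst, eval_pX2; fold (ev x).
    change (psum (monomial x (Rpower x beta))) with (ev x).
    match goal with |- Rabs ?t <= _ => replace t with
      (- ((fa x - ev x (ca Y)) * fe x) + - (ev x (ca Y) * (fe x - ev x (ce Y)))
       + - (sig * (Rpower x beta * (fs x - ev x (cs Y))))
       + - (m * ((fy x - ev x (cy Y)) * (2 + fa x) + ev x (cy Y) * (fa x - ev x (ca Y)))))
      by ring end.
    abs_bound; auto.
  - apply component_step with (g := fun x =>
      fe x - fa x * fa x + m * (fy x * (2 + fa x))) (q := 2);
      auto; try lra; [apply (ps_a _ _ _ _ _ _ _ _ _ _ PS) | destruct NY; nonconst_tac |].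
    intros x Hx; destruct (ST x Hx) as [_ [_ [E _]]]; fold (w x).
    apply g2 in E; rewrite ?Rmult_assoc in E; rewrite ?Rmult_assoc; eapply Rle_trans; [| exact E].
    rewrite !psum_app, !eval_pmul, !psum_app, !eval_pcst.
    change (psum (monomial x (Rpower x beta))) with (ev x).
    match goal with |- Rabs ?t <= _ => replace t with
      ((fe x - ev x (ce Y))
       + - ((fa x - ev x (ca Y)) * fa x + ev x (ca Y) * (fa x - ev x (ca Y)))
       + m * ((fy x - ev x (cy Y)) * (2 + fa x) + ev x (cy Y) * (fa x - ev x (ca Y))))
      by ring end.
    abs_bound; auto.
  - apply component_step with (g := fun x => - ((n * fa x + fy x) * (1 + fs x))) (q := gam);
      auto; try lra; [apply Rmult_le_pos; lra | apply (ps_s _ _ _ _ _ _ _ _ _ _ PS)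
        | destruct NY; nonconst_tac |].
    intros x Hx; destruct (ST x Hx) as [_ [_ [_ [E _]]]]; fold (w x).
    apply g0 in E; rewrite ?Rmult_assoc in E; rewrite ?Rmult_assoc; eapply Rle_trans; [| exact E].
    rewrite !eval_pmul, !psum_app, !eval_pmul, !eval_pcst.
    change (psum (monomial x (Rpower x beta))) with (ev x).
    match goal with |- Rabs ?t <= _ => replace t with
      (- ((n * (fa x - ev x (ca Y)) + (fy x - ev x (cy Y))) * (1 + fs x))
       + - ((n * ev x (ca Y) + ev x (cy Y)) * (fs x - ev x (cs Y)))) by ring end.
    abs_bound; auto.
  - apply component_step with (g := fun x => fa x * (1 + fu x)) (q := gam);
      auto; try lra; [apply Rmult_le_pos; lra | apply (ps_u _ _ _ _ _ _ _ _ _ _ PS)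
        | destruct NY; nonconst_tac |].
    intros x Hx; destruct (ST x Hx) as [_ [_ [_ [_ E]]]]; fold (w x).
    apply g0 in E; rewrite ?Rmult_assoc in E; rewrite ?Rmult_assoc; eapply Rle_trans; [| exact E].
    rewrite !eval_pmul, !psum_app, !eval_pcst.
    change (psum (monomial x (Rpower x beta))) with (ev x).
    match goal with |- Rabs ?t <= _ => replace t with
      ((fa x - ev x (ca Y)) * (1 + fu x) + ev x (ca Y) * (fu x - ev x (cu Y))) by ring end.
    abs_bound; auto.
Qed.

(** * The expansion *)

Lemma profile_profile_system p n H H1 P gam :
  0 < n < 3 / 2 -> profile (INR p) n H H1 P -> 0 < gam <= 1 -> gam <= 3 - 2 * n ->
  exists kappa, 0 < kappa /\ exists fy fe fa fs,
    profile_system (INR p) n (3 - 2 * n) (Rpower kappa (- n)) gam fy fe fa fs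
      (fun x => H x / (kappa * x ^ 2) - 1).
Proof.
  intros Hn PR Hg Hgb.
  destruct (profile_expansion p n H H1 P gam ltac:(lra) PR Hg Hgb)
    as [kappa [Hk [BP [B1 B0]]]].
  exists kappa; split; [easy |].
  set (fy := fun x => x / (1 - x)).
  set (fa := fun x => x * H1 x / H x - 2).
  set (fe := fun x => (x ^ 2 * P x - x * H1 x) / H x).
  set (fu := fun x => H x / (kappa * x ^ 2) - 1).
  set (fs := fun x => (1 - x) * Rpower (1 + fu x) (- n) - 1).
  exists fy, fe, fa, fs.
  assert (Hpos := pr_pos _ _ _ _ _ PR).
  assert (HdH := pr_H _ _ _ _ _ PR); assert (HdH1 := pr_H1 _ _ _ _ _ PR).
  assert (HdP := pr_P _ _ _ _ _ PR).
  assert (X2 : forall x, 0 < x -> 0 < kappa * x ^ 2)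
    by (intros; apply Rmult_lt_0_compat; [easy | now apply pow_lt]).
  assert (BI := bigO_inv_H p n H H1 P PR).
  assert (Oy : bigO gam fy).
  { apply bigO_weaken with 1; [easy |].
    apply bigO_mult with 1 0; [ring | apply bigO_id | apply bigO_inv_1mx]. }
  (* The leading terms 2 kappa x^2 of [x * H1 x] and of [2 * H x] cancel; division by [H] then costs
     x^2. The bound for [fe] has the same pattern. *)
  assert (Oa : bigO gam fa).
  { apply bigO_ext with (fun x =>
      (x * (H1 x - 2 * kappa * x) + -2 * (H x - kappa * x ^ 2)) * / H x).
    - intros x Hx; specialize (Hpos x Hx); unfold fa; field; lra.
    - apply bigO_mult with (2 + gam) (-2); [ring | | exact BI].
      apply bigO_plus; [| now apply bigO_scal].
      apply bigO_mult with 1 (1 + gam); [ring | apply bigO_id | exact B1]. }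
  assert (Oe : bigO gam fe).
  { apply bigO_ext with (fun x =>
      (x * (x * (P x - 2 * kappa)) + -1 * (x * (H1 x - 2 * kappa * x))) * / H x).
    - intros x Hx; specialize (Hpos x Hx); unfold fe; field; lra.
    - apply bigO_mult with (2 + gam) (-2); [ring | | exact BI].
      apply bigO_plus; [| apply bigO_scal];
        apply bigO_mult with 1 (1 + gam); try ring; try apply bigO_id; [| exact B1].
      apply bigO_mult with 1 gam; [ring | apply bigO_id | exact BP]. }
  assert (Ou : bigO gam fu).
  { apply bigO_ext with (fun x => (H x - kappa * x ^ 2) * (/ kappa * / (x ^ 2))).
    - intros x Hx; unfold fu; field; lra.
    - apply bigO_mult with (2 + gam) (-2); [ring | exact B0 |]; apply bigO_scal.
      exists 1, 1; split; [lra |]; intros x Hx.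
      replace (-2) with (Ropp 2) by ring; rewrite (Rpower_Ropp x 2), Rpower_2 by lra.
      assert (0 < / x ^ 2) by (apply Rinv_0_lt_compat, pow_lt; lra).
      rewrite Rabs_right; lra. }
  assert (Lu : lim0 fu) by (apply bigO_lim0 with gam; [lra | exact Ou]).
  assert (u1 : forall x, 0 < x < 1 -> 0 < 1 + fu x).
  { intros x Hx; unfold fu; replace (1 + (_ - 1)) with (H x / (kappa * x ^ 2)) by ring.
    apply Rdiv_lt_0_compat; [now apply Hpos | apply X2; lra]. }
  assert (Ls : lim0 fs).
  { intros eps He.
    assert (C : continuous (fun z => Rpower z (- n)) 1).
    { apply (ex_derive_continuous (fun z => Rpower z (- n))).
      exists (- n * (Rpower 1 (- n) / 1)); apply is_derive_Rpower; lra. }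
    assert (E1 : Rpower 1 (- n) = 1) by (unfold Rpower; rewrite ln_1, Rmult_0_r; apply exp_0).
    (* With [z] the power of 1 + u, one has (1 - x) z - 1 = (z - 1) - x z. If x and |z - 1| are
       below delta <= 1, this is at most delta + delta (1 + delta) <= 3 delta. *)
    assert (e3 : 0 < Rmin 1 (eps / 3)) by (apply Rmin_pos; lra).
    apply filterlim_locally with (eps := mkposreal _ e3) in C; destruct C as [d Hd].
    destruct (Lu d (cond_pos d)) as [eta [Eta Heta]].
    exists (Rmin (Rmin 1 (eps / 3)) eta); split; [apply Rmin_pos; lra |]; intros x Hx.
    assert (M1 := Rmin_l (Rmin 1 (eps / 3)) eta); assert (M2 := Rmin_r (Rmin 1 (eps / 3)) eta).
    assert (M3 := Rmin_l 1 (eps / 3)); assert (M4 := Rmin_r 1 (eps / 3)).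
    specialize (Hd (1 + fu x)).
    assert (Bd : ball 1 d (1 + fu x)).
    { change (Rabs (1 + fu x - 1) < d); replace (1 + fu x - 1) with (fu x) by ring.
      apply Heta; lra. }
    specialize (Hd Bd).
    change (Rabs (Rpower (1 + fu x) (- n) - Rpower 1 (- n)) < Rmin 1 (eps / 3)) in Hd.
    rewrite E1 in Hd; apply Rabs_def2 in Hd.
    unfold fs; set (z := Rpower (1 + fu x) (- n)) in *.
    apply Rabs_def1; nra. }
  (* The equation for P' enters here: x^3 (1 - x) H^(-n), with H = kappa x^2 (1 + u), gives sigma =
     kappa^(-n), the exponent beta = 3 - 2 n and the definition of [s]. *)
  assert (DP : forall x, 0 < x < 1 ->
    x * (x ^ 2 * - ((1 - x) * Rpower (H x) (1 - n))) / H x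
    = - (Rpower kappa (- n) * (Rpower x (3 - 2 * n) * (1 + fs x)))).
  { intros x Hx; assert (h := Hpos x Hx).
    assert (hx : 0 < kappa * x ^ 2) by (apply X2; lra).
    unfold fs, fu; replace (1 + (_ / _ - 1)) with (H x / (kappa * x ^ 2)) by ring.
    replace (H x / (kappa * x ^ 2)) with (H x * / (kappa * x ^ 2)) by easy.
    rewrite <- Rpower_mult_distr by (auto; now apply Rinv_0_lt_compat).
    replace (Rpower (/ (kappa * x ^ 2)) (- n)) with (Rpower kappa n * Rpower x (2 * n)).
    2:{ rewrite <- Rpower_square, Rpower_mult_distr by (try apply pow_lt; lra).
        rewrite <- (Rpower_1 (kappa * x ^ 2)) at 2 by easy.
        rewrite <- Rpower_Ropp, Rpower_mult; f_equal; ring. }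
    replace (1 - n) with (1 + - n) by ring.
    rewrite (Rpower_plus 1 (- n) (H x)), Rpower_1 by easy.
    replace (3 - 2 * n) with (3 + - (2 * n)) by ring.
    rewrite Rpower_plus, (Rpower_Ropp x (2 * n)), (Rpower_Ropp kappa).
    replace (Rpower x 3) with (x ^ 3) by (rewrite <- Rpower_pow by lra; f_equal; simpl; ring).
    assert (A := Rpower_pos kappa n); assert (B := Rpower_pos x (2 * n)).
    field; repeat split; lra. }
  assert (Du : forall x, 0 < x < 1 -> is_derive fu x (fa x * (1 + fu x) / x)).
  { intros x Hx; assert (h := Hpos x Hx); unfold fu; evar_last.
    - apply (is_derive_minus (fun x => H x / (kappa * x ^ 2)) (fun _ => 1));
        [| apply is_derive_const].
      apply (is_derive_div H (fun x => kappa * x ^ 2)); [now apply HdH | |].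
      + auto_derive; [easy | reflexivity].
      + apply Rgt_not_eq, X2; lra.
    - unfold minus, plus, opp, zero, fa; simpl; field; lra. }
  assert (Ss : theta_solves 0 fs (fun x => - ((n * fa x + fy x) * (1 + fs x)))).
  { split; [exact Ls |].
    exists (fun x => - ((n * fa x + fy x) * (1 + fs x)) / x); intros x Hx; split; [| field; lra].
    specialize (u1 x Hx); unfold fs; evar_last.
    - apply (is_derive_minus (fun x => (1 - x) * Rpower (1 + fu x) (- n)) (fun _ => 1));
        [| apply is_derive_const].
      apply (is_derive_mult (fun x => 1 - x) (fun x => Rpower (1 + fu x) (- n)));
        [| | intros; apply Rmult_comm].
      + auto_derive; [easy | reflexivity].
      + apply (is_derive_comp (fun z => Rpower z (- n)) (fun x => 1 + fu x));
          [now apply is_derive_Rpower |].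
        apply (is_derive_plus (fun _ => 1) fu); [apply is_derive_const | now apply Du].
    - unfold minus, plus, opp, mult, scal, zero, fy; simpl; unfold mult; simpl; field; lra. }
  split; auto.
  - intros x Hx; unfold fy; field; lra.
  - split; [apply bigO_lim0 with gam; [lra | exact Oe] |].
    eexists; intros x Hx; assert (h := Hpos x Hx); split.
    + unfold fe.
      apply (is_derive_div (fun x => x ^ 2 * P x - x * H1 x) H); [| now apply HdH | lra].
      apply (is_derive_minus (fun x => x ^ 2 * P x) (fun x => x * H1 x)).
      * apply (is_derive_mult (fun x => x ^ 2) P); [| now apply HdP | intros; apply Rmult_comm].
        auto_derive; [easy | reflexivity].
      * apply (is_derive_mult (fun x => x) H1);
          [apply is_derive_id | now apply HdH1 | intros; apply Rmult_comm].
    + specialize (DP x Hx).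
      replace (Rpower kappa (- n) * (Rpower x (3 - 2 * n) * (1 + fs x)))
        with (- (x * (x ^ 2 * - ((1 - x) * Rpower (H x) (1 - n))) / H x)) by lra.
      unfold minus, plus, opp, mult, one, fe, fa, fy; simpl; field; lra.
  - split; [apply bigO_lim0 with gam; [lra | exact Oa] |].
    eexists; intros x Hx; assert (h := Hpos x Hx); split.
    + unfold fa.
      apply (is_derive_minus (fun x => x * H1 x / H x) (fun _ => 2)); [| apply is_derive_const].
      apply (is_derive_div (fun x => x * H1 x) H); [| now apply HdH | lra].
      apply (is_derive_mult (fun x => x) H1);
        [apply is_derive_id | now apply HdH1 | intros; apply Rmult_comm].
    + unfold minus, plus, opp, mult, one, zero, fe, fa, fy; simpl; field; lra.
  - split; [exact Lu |].
    exists (fun x => fa x * (1 + fu x) / x); intros x Hx; split; [now apply Du | field; lra].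
  (* The order of [s] follows from its own equation: the limit [Ls] makes 1 + s bounded, so the
     source n a + y times 1 + s is of order x^gam. *)
  - destruct Ss as [_ [df Hdf]].
    apply bigO_theta with df (fun x => - ((n * fa x + fy x) * (1 + fs x))) 0; try lra; auto;
      try (intros; now apply Hdf).
    apply bigO_ext with (fun x => -1 * ((n * fa x + fy x) * (1 + fs x))); [intros; ring |].
    apply bigO_scal, bigO_mult with gam 0; [ring | |].
    + apply bigO_plus; [now apply bigO_scal | exact Oy].
    + apply bigO_plus; [apply bigO_const |].
      destruct (Ls 1 ltac:(lra)) as [eta [E1 E2]].
      exists 1, (Rmin 1 eta); assert (M1 := Rmin_l 1 eta); assert (M2 := Rmin_r 1 eta).
      split; [split; [apply Rmin_pos; lra |]; lra |]; intros x Hx.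
      rewrite Rpower_O by lra; specialize (E2 x ltac:(lra)); lra.
Qed.

(** C x^gam = (C c^gam) (x/c)^gam: in the weight attached to [[0, c]] the size of a fixed function
    tends to 0 with [c]. *)
Lemma bigO_eventually gam f b :
  0 < gam -> bigO gam f -> 0 < b ->
  exists c0, 0 < c0 /\ forall c, 0 < c < c0 -> forall x, 0 < x <= c ->
    Rabs (f x) <= b * (Rpower x gam / Rpower c gam).
Proof.
  intros Hg [C [eta [He Hf]]] Hb.
  destruct (lim0_scal C _ (lim0_Rpower gam Hg) b Hb) as [e2 [E1 E2]].
  exists (Rmin eta e2); split; [apply Rmin_pos; lra |]; intros c Hc x Hx.
  assert (M1 := Rmin_l eta e2); assert (M2 := Rmin_r eta e2).
  eapply Rle_trans; [apply Hf; lra |].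
  specialize (E2 c ltac:(lra)); assert (A := Rle_abs (C * Rpower c gam)).
  assert (Pc := Rpower_pos c gam); assert (Px := Rpower_pos x gam).
  replace (C * Rpower x gam) with ((C * Rpower c gam) * (Rpower x gam / Rpower c gam))
    by (field; lra).
  apply Rmult_le_compat_r; [apply Rlt_le, Rdiv_lt_0_compat |]; lra.
Qed.

(** [K], [del] and [Rb] are fixed before [c]; then [c] is shrunk until all smallness conditions
    hold. It serves both as interval length and as radius in [x1], with radius c^beta in [x2], so
    [(x, x^beta)] stays in the polydisc for 0 < x <= c. *)
Lemma profile_system_small m n beta sig gam fy fe fa fs fu :
  0 <= m -> 0 < n -> 0 < gam <= 1 -> 0 < sig -> 0 < beta ->
  profile_system m n beta sig gam fy fe fa fs fu ->
  exists K del Rb c, 0 < c < 1 /\ 0 < K /\ 0 < Rb /\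
    small_params m n gam sig K del Rb c (Rpower c beta) /\
    close beta gam c K del Rb fy fe fa fs fu state0.
Proof.
  intros Hm Hn Hg Hsig Hb PS.
  set (K := 4 * (n + 2) / gam); set (del := / (16 * (m + 1))); set (Rb := / (2 * K + 8)).
  assert (K0 : 0 < K) by (apply Rdiv_lt_0_compat; lra).
  assert (d0 : 0 < del) by (apply Rinv_0_lt_compat; lra).
  assert (R0 : 0 < Rb) by (apply Rinv_0_lt_compat; lra).
  assert (dR : 0 < del * Rb) by (now apply Rmult_lt_0_compat).
  assert (KR : 0 < K * Rb) by (now apply Rmult_lt_0_compat).
  destruct (bigO_eventually gam fy _ ltac:(lra) (ps_Oy _ _ _ _ _ _ _ _ _ _ PS) dR) as [c1 [A1 B1]].
  destruct (bigO_eventually gam fe _ ltac:(lra) (ps_Oe _ _ _ _ _ _ _ _ _ _ PS) R0) as [c2 [A2 B2]].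
  destruct (bigO_eventually gam fa _ ltac:(lra) (ps_Oa _ _ _ _ _ _ _ _ _ _ PS) R0) as [c3 [A3 B3]].
  destruct (bigO_eventually gam fs _ ltac:(lra) (ps_Os _ _ _ _ _ _ _ _ _ _ PS) KR) as [c4 [A4 B4]].
  destruct (bigO_eventually gam fu _ ltac:(lra) (ps_Ou _ _ _ _ _ _ _ _ _ _ PS) KR) as [c5 [A5 B5]].
  destruct (lim0_scal sig _ (lim0_Rpower beta Hb) (Rb / 4) ltac:(lra)) as [c6 [A6 B6]].
  assert (E : exists c, 0 < c < 1 /\ c <= del * Rb / 4 /\
    c < c1 /\ c < c2 /\ c < c3 /\ c < c4 /\ c < c5 /\ c < c6).
  { set (z := Rmin (Rmin (Rmin 1 (del * Rb / 4)) (Rmin c1 c2)) (Rmin (Rmin c3 c4) (Rmin c5 c6))).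
    exists (z / 2).
    assert (z0 : 0 < z) by (unfold z; repeat apply Rmin_pos; lra).
    assert (Q1 := Rmin_l (Rmin (Rmin 1 (del * Rb / 4)) (Rmin c1 c2)) (Rmin (Rmin c3 c4) (Rmin c5 c6))).
    assert (Q2 := Rmin_r (Rmin (Rmin 1 (del * Rb / 4)) (Rmin c1 c2)) (Rmin (Rmin c3 c4) (Rmin c5 c6))).
    fold z in Q1, Q2.
    assert (Q3 := Rmin_l (Rmin 1 (del * Rb / 4)) (Rmin c1 c2)).
    assert (Q4 := Rmin_r (Rmin 1 (del * Rb / 4)) (Rmin c1 c2)).
    assert (Q5 := Rmin_l (Rmin c3 c4) (Rmin c5 c6)); assert (Q6 := Rmin_r (Rmin c3 c4) (Rmin c5 c6)).
    assert (Q7 := Rmin_l 1 (del * Rb / 4)); assert (Q8 := Rmin_r 1 (del * Rb / 4)).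
    assert (Q9 := Rmin_l c1 c2); assert (Q10 := Rmin_r c1 c2).
    assert (Q11 := Rmin_l c3 c4); assert (Q12 := Rmin_r c3 c4).
    assert (Q13 := Rmin_l c5 c6); assert (Q14 := Rmin_r c5 c6).
    repeat split; lra. }
  destruct E as [c [Hc [Hcr [E1 [E2 [E3 [E4 [E5 E6]]]]]]]].
  exists K, del, Rb, c; repeat split; try lra; try reflexivity.
  - apply Rpower_pos.
  - specialize (B6 c ltac:(lra)); assert (A := Rle_abs (sig * Rpower c beta)); lra.
  - intros x Hx; simpl; rewrite Rminus_0_r; apply B1; lra.
  - intros x Hx; simpl; rewrite Rminus_0_r; apply B2; lra.
  - intros x Hx; simpl; rewrite Rminus_0_r; apply B3; lra.
  - intros x Hx; simpl; rewrite Rminus_0_r; apply B4; lra.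
  - intros x Hx; simpl; rewrite Rminus_0_r; apply B5; lra.
Qed.

Lemma close_iter m n beta gam sig K del Rb c fy fe fa fs fu k :
  small_params m n gam sig K del Rb c (Rpower c beta) ->
  0 < beta -> gam <= beta -> c < 1 ->
  profile_system m n beta sig gam fy fe fa fs fu ->
  close beta gam c K del Rb fy fe fa fs fu state0 ->
  close beta gam c K del (Rb * (3 / 4) ^ k) fy fe fa fs fu (Yk m n beta sig k).
Proof.
  intros SP Hb Hgb Hc PS C0.
  assert (CC := small_params_contraction _ _ _ _ _ _ _ _ _ SP).
  assert (KK := cc_K _ _ _ _ _ _ _ _ _ CC); assert (dd := cc_del _ _ _ _ _ _ _ _ _ CC).
  assert (RR := cc_R _ _ _ _ _ _ _ _ _ CC).
  assert (Q : forall j, 0 <= (3 / 4) ^ j) by (intros; apply pow_le; lra).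
  induction k as [|k IH]; [now rewrite pow_O, Rmult_1_r |].
  replace (Rb * (3 / 4) ^ S k) with (3 / 4 * (Rb * (3 / 4) ^ k)) by (simpl; ring).
  eapply close_eq; [apply Yk_phi |].
  specialize (Q k); assert (B := proj1 (iter_bound m n beta gam sig K del Rb c _ k SP Hb Hgb)).
  eapply close_step; eauto.
  - apply Rmult_le_pos; lra.
  - apply iter_nonconst.
  - destruct B; split; eapply Rle_trans; eauto;
      repeat (apply Rmult_le_compat_l; [lra |]); nra.
Qed.

Lemma geometric_iter m n beta gam sig K del Rb r s :
  small_params m n gam sig K del Rb r s -> 0 < beta -> gam <= beta ->
  geometric (fun k => cu (Dk m n beta sig k)) r s (K * (Rb / 4)) (3 / 4).
Proof.
  intros SP Hb Hgb.
  assert (CC := small_params_contraction _ _ _ _ _ _ _ _ _ SP).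
  assert (KK := cc_K _ _ _ _ _ _ _ _ _ CC); assert (RR := cc_R _ _ _ _ _ _ _ _ _ CC).
  split; try lra; try apply SP.
  - apply Rmult_le_pos; lra.
  - intros k; apply (nc_u _ (proj2 (iter_nonconst m n beta sig k))).
  - intros k; rewrite Rmult_assoc.
    apply (sb_u _ _ _ _ _ _ (proj2 (iter_bound m n beta gam sig K del Rb r s k SP Hb Hgb))).
Qed.

(** Both sides are limits of one sequence, the iterates evaluated at [(x, x^beta)]: one by
    summability of the increments, the other by closeness to the functions coming from [H]. *)
Lemma profile_system_plim m n beta gam sig K del Rb c fy fe fa fs fu x :
  small_params m n gam sig K del Rb c (Rpower c beta) ->
  0 < beta -> gam <= beta -> c < 1 ->
  profile_system m n beta sig gam fy fe fa fs fu ->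
  close beta gam c K del Rb fy fe fa fs fu state0 ->
  0 < x <= c ->
  fu x = plim (fun k => cu (Dk m n beta sig k)) x (Rpower x beta).
Proof.
  intros SP Hb Hgb Hc PS C0 Hx.
  assert (G := geometric_iter m n beta gam sig K del Rb c _ SP Hb Hgb).
  assert (L1 : is_lim_seq (fun k => psum (monomial x (Rpower x beta))
    (pconcat (fun k => cu (Dk m n beta sig k)) k))
    (plim (fun k => cu (Dk m n beta sig k)) x (Rpower x beta))).
  { apply plim_spec with (1 := G).
    - rewrite Rabs_right; lra.
    - rewrite Rabs_right by (apply Rle_ge, Rlt_le, Rpower_pos); apply Rle_Rpower_l; lra. }
  set (w := Rpower x gam / Rpower c gam).
  assert (L2 : is_lim_seq (fun k => psum (monomial x (Rpower x beta))
    (pconcat (fun k => cu (Dk m n beta sig k)) k)) (fu x)).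
  { assert (L0 : is_lim_seq (fun k => K * Rb * w * (3 / 4) ^ k) 0).
    { replace (Finite 0) with (Rbar_mult (K * Rb * w) 0) by (simpl; f_equal; ring).
      apply is_lim_seq_scal_l, is_lim_seq_geom; rewrite Rabs_right; lra. }
    apply is_lim_seq_spec in L0; apply is_lim_seq_spec; intros eps.
    destruct (L0 eps) as [N HN]; exists N; intros k Hk; specialize (HN k Hk).
    rewrite Rminus_0_r in HN; rewrite <- cu_Yk, Rabs_minus_sym.
    eapply Rle_lt_trans; [| exact HN]; eapply Rle_trans; [| apply Rle_abs].
    eapply Rle_trans;
      [apply (cl_u _ _ _ _ _ _ _ _ _ _ _ _
        (close_iter m n beta gam sig K del Rb c fy fe fa fs fu k SP Hb Hgb Hc PS C0) x Hx) |].
    fold w; right; ring. }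
  apply is_lim_seq_unique in L1; apply is_lim_seq_unique in L2.
  rewrite L1 in L2; now injection L2.
Qed.

(** * From a classical solution to a profile *)

Lemma is_derive_within_0_unique f l1 l2 :
  is_derive_within I01 f 0 l1 -> is_derive_within I01 f 0 l2 -> l1 = l2.
Proof.
  intros H1 H2.
  assert (PF : ProperFilter' (within I01 (locally' 0))).
  { apply Build_ProperFilter'; [| apply within_filter, locally'_filter].
    intros [d Hd].
    assert (A := cond_pos d); assert (M1 := Rmin_l (d / 2) 1); assert (M2 := Rmin_r (d / 2) 1).
    assert (M3 : 0 < Rmin (d / 2) 1) by (apply Rmin_pos; lra).
    apply (Hd (Rmin (d / 2) 1)).
    - change (Rabs (Rmin (d / 2) 1 - 0) < d); rewrite Rminus_0_r, Rabs_right; lra.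
    - lra.
    - split; lra. }
  exact (filterlim_locally_unique _ _ _ H1 H2).
Qed.

Lemma solution_profile d n H :
  (1 <= d)%nat -> is_solution d n H ->
  profile (INR (d - 1)) n H (Derive H)
    (fun x => Derive_n H 2 x - INR (d - 1) / (1 - x) * Derive H x).
Proof.
  intros Hd [S3 S1 Sp So S0 Sd0 _].
  set (m := INR (d - 1)).
  assert (Em : INR d - 1 = m) by (unfold m; rewrite minus_INR by easy; easy).
  assert (D1 : forall x, 0 < x < 1 -> is_derive H x (Derive H x)).
  { intros x Hx; apply Derive_correct; exact (proj1 (S3 x Hx) 1%nat ltac:(lia)). }
  assert (D2 : forall x, 0 < x < 1 -> is_derive (Derive H) x (Derive_n H 2 x)).
  { intros x Hx; apply (Derive_correct (Derive H) x); exact (proj1 (S3 x Hx) 2%nat ltac:(lia)). }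
  assert (D3 : forall x, 0 < x < 1 -> is_derive (Derive_n H 2) x (Derive_n H 3 x)).
  { intros x Hx; apply (Derive_correct (Derive_n H 2) x); exact (proj1 (S3 x Hx) 3%nat ltac:(lia)). }
  split; auto.
  - intros x Hx; evar_last; [now apply D2 | ring].
  - intros x Hx; specialize (So x Hx); rewrite Em in So.
    evar_last.
    (* Differentiating m / (1 - x) H' yields exactly the two lower-order terms of the equation,
       which is therefore a formula for P'. *)
    + apply (is_derive_minus (Derive_n H 2) (fun x => m / (1 - x) * Derive H x));
        [now apply D3 |].
      apply (is_derive_mult (fun x => m / (1 - x)) (Derive H));
        [| now apply D2 | intros; apply Rmult_comm].
      auto_derive; [lra | reflexivity].
    + assert (A := Rpower_pos (H x) (n - 1)).
      apply Rmult_eq_reg_l with (Rpower (H x) (n - 1)); [| lra].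
      replace (Rpower (H x) (n - 1) * - ((1 - x) * Rpower (H x) (1 - n)))
        with (- (1 - x) * (Rpower (H x) (n - 1) * Rpower (H x) (1 - n))) by ring.
      rewrite <- Rpower_plus; replace (n - 1 + (1 - n)) with 0 by ring.
      rewrite Rpower_O by (apply Sp; lra).
      transitivity (- 1 + x); [rewrite <- So | ring].
      change (Derive_n H 1 x) with (Derive H x).
      unfold minus, plus, opp, mult; simpl; field; lra.
  - intros x Hx; apply Sp; lra.
  - intros eps He.
    (* Since H(0) = H'(0) = 0, the difference quotient at 0 is below 1 nearby, so that |H x| < x. *)
    apply filterlim_locally with (eps := mkposreal 1 Rlt_0_1) in Sd0.
    destruct Sd0 as [dl Hdl].
    exists (Rmin (Rmin 1 eps) dl).
    assert (M1 := Rmin_l (Rmin 1 eps) dl); assert (M2 := Rmin_r (Rmin 1 eps) dl).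
    assert (M3 := Rmin_l 1 eps); assert (M4 := Rmin_r 1 eps).
    split; [repeat apply Rmin_pos; try lra; apply cond_pos |]; intros x Hx.
    assert (B : ball 0 1 ((H x - H 0) / (x - 0))).
    { apply Hdl; [| lra | split; lra].
      change (Rabs (x - 0) < dl); rewrite Rminus_0_r, Rabs_right; lra. }
    change (Rabs ((H x - H 0) / (x - 0) - 0) < 1) in B.
    rewrite S0, !Rminus_0_r in B; unfold Rdiv in B.
    rewrite Rabs_mult, Rabs_inv, (Rabs_right x) in B by lra.
    apply Rmult_lt_compat_r with (r := x) in B; [| lra].
    rewrite Rmult_assoc, Rinv_l in B by lra; lra.
  - destruct S1 as [f' [F1 F2]].
    (* The continuous derivative supplied by [C1_closed] has to take the boundary value 0; with its
       continuity, H' tends to 0. *)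
    assert (E0 : f' 0 = 0).
    { apply (is_derive_within_0_unique H); [apply F1; split; lra | exact Sd0]. }
    (* At an interior point small increments stay in [[0, 1]], so the derivative within the interval
       is the two-sided one. *)
    assert (Ei : forall x, 0 < x < 1 -> Derive H x = f' x).
    { intros x Hx; apply is_derive_unique, is_derive_Reals.
      specialize (F1 x ltac:(split; lra)); intros eps He.
      apply filterlim_locally with (eps := mkposreal eps He) in F1; destruct F1 as [dl Hdl].
      assert (M : 0 < Rmin dl (Rmin x (1 - x)))
        by (apply Rmin_pos; [apply cond_pos | apply Rmin_pos; lra]).
      exists (mkposreal _ M); intros h Hh0 Hh; simpl in Hh.
      assert (M1 := Rmin_l dl (Rmin x (1 - x))); assert (M2 := Rmin_r dl (Rmin x (1 - x))).
      assert (M3 := Rmin_l x (1 - x)); assert (M4 := Rmin_r x (1 - x)).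
      assert (A := Rabs_def2 _ _ Hh).
      assert (B : ball (f' x) eps ((H (x + h) - H x) / (x + h - x))).
      { apply Hdl; [| lra | split; lra].
        change (Rabs (x + h - x) < dl); replace (x + h - x) with h by ring; lra. }
      change (Rabs ((H (x + h) - H x) / (x + h - x) - f' x) < eps) in B.
      now replace (x + h - x) with h in B by ring. }
    intros eps He.
    assert (F := F2 0 ltac:(split; lra)).
    apply filterlim_locally with (eps := mkposreal eps He) in F; destruct F as [dl Hdl].
    exists (Rmin 1 dl); assert (M1 := Rmin_l 1 dl); assert (M2 := Rmin_r 1 dl).
    split; [apply Rmin_pos; [lra | apply cond_pos] |]; intros x Hx.
    rewrite Ei by lra.
    assert (B : ball (f' 0) eps (f' x)).
    { apply Hdl; [| split; lra].
      change (Rabs (x - 0) < dl); rewrite Rminus_0_r, Rabs_right; lra. }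
    change (Rabs (f' x - f' 0) < eps) in B; now rewrite E0, Rminus_0_r in B.
Qed.

Theorem theoremA1 (d : nat) (n : R) (H : R -> R)
  (hd : (1 <= d)%nat) (hn : 0 < n < 3 / 2)
  (hH : is_unique_solution d n H) :
  exists kappa : R, 0 < kappa /\
  exists v : R -> R -> R,
    analytic_near v 0 0 /\
    v 0 0 = 0 /\
    ~ locally_2d (fun x1 x2 => v x1 x2 = 0) 0 0 /\
    depends_on_fst v /\
    depends_on_snd v /\
    exists c : R, 0 < c /\
      forall x, 0 <= x <= c ->
        H x = kappa * x ^ 2 * (1 + v x (rpow x (3 - 2 * n))).
Proof.
  destruct hH as [hS _].
  set (gam := Rmin 1 (3 - 2 * n)).
  assert (Hg : 0 < gam <= 1) by (split; [apply Rmin_pos; lra | apply Rmin_l]).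
  assert (Hgb : gam <= 3 - 2 * n) by apply Rmin_r.
  assert (Hb : 0 < 3 - 2 * n) by lra.
  assert (PR := solution_profile d n H hd hS).
  destruct (profile_profile_system _ n H _ _ gam hn PR Hg Hgb)
    as [kappa [Hk [fy [fe [fa [fs PS]]]]]].
  set (m := INR (d - 1)) in *; set (sig := Rpower kappa (- n)) in *.
  assert (Hsig : 0 < sig) by apply Rpower_pos.
  destruct (profile_system_small m n (3 - 2 * n) sig gam fy fe fa fs _
    (pos_INR _) (proj1 hn) Hg Hsig Hb PS) as [K [del [Rb [c [Hc [HK [HR [SP C0]]]]]]]].
  assert (G := geometric_iter m n (3 - 2 * n) gam sig K del Rb c _ SP Hb Hgb).
  exists kappa; split; [easy |].
  exists (plim (fun k => cu (Dk m n (3 - 2 * n) sig k))).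
  (* The coefficient of [x2] is negative for every [d], since sigma > 0; it settles both the
     non-triviality of [v] and its dependence on the second variable. *)
  destruct (plim_nonconstant_snd _ _ _ _ _
    (- sig / ((3 - 2 * n) * (3 - 2 * n + 1) * (3 - 2 * n + 2))) 3 G) as [N1 N2].
  { apply Rmult_integral_contrapositive; split; [lra |].
    apply Rinv_neq_0_compat, Rgt_not_eq; repeat apply Rmult_lt_0_compat; lra. }
  { intros k Hk3; rewrite <- cu_Yk; replace k with (S (S (S (k - 3)))) by lia.
    now apply coef01_u. }
  repeat split; auto.
  - apply analytic_near_of_geometric with c (Rpower c (3 - 2 * n)) (K * (Rb / 4)) (3 / 4);
      apply G.
  - now apply plim_00 with (1 := G).
  - destruct (Nat.eq_dec (d - 1) 0) as [E|E].
    + assert (m0 : m = 0) by (unfold m; rewrite E; easy).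
      apply plim_depends_fst_mixed with (1 := G) (k0 := 5%nat)
        (c := sig / ((3 - 2 * n + 1) * (3 - 2 * n + 2) * (3 - 2 * n + 3))).
      * apply Rgt_not_eq, Rdiv_lt_0_compat; [easy | repeat apply Rmult_lt_0_compat; lra].
      * intros k Hk5; rewrite <- cu_Yk, m0.
        replace k with (S (S (S (S (S (k - 5)))))) by lia; now apply coef11_u0.
    + apply plim_depends_fst with (1 := G) (k0 := 4%nat) (c := m / 3).
      * apply Rgt_not_eq, Rdiv_lt_0_compat; [apply lt_0_INR; lia | lra].
      * intros k Hk4; rewrite <- cu_Yk.
        replace k with (S (S (S (S (k - 4))))) by lia; apply coef10_u.
  - exists c; split; [easy |]; intros x Hx; unfold rpow.
    destruct (Rlt_dec 0 x) as [x0|x0].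
    + rewrite <- (profile_system_plim m n (3 - 2 * n) gam sig K del Rb c fy fe fa fs _ x
        SP Hb Hgb (proj2 Hc) PS C0) by lra.
      field; lra.
    (* At x = 0 both sides vanish, the right one through its factor x^2. *)
    + assert (x = 0) as -> by lra.
      rewrite (sol_val0 _ _ _ hS); ring.
Qed.
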